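(* Let $\mathbb{F}$ be an algebraically closed field, let $n\ge 3$ and $k\ge 2$ be integers, and let $$\mathfrak{p}(x_1,\dots,x_k)=\sum_{\sigma\in\mathcal{S}_k}\alpha_\sigma\, x_{\sigma(1)}\cdots x_{\sigma(k)}\qquad(\alpha_\sigma\in\mathbb{F})$$ be a homogeneous multilinear polynomial in noncommuting variables with $\sum_{\sigma\in\mathcal{S}_k}\alpha_\sigma\ne 0$. Let $\mathfrak{D}_1,\mathfrak{D}_2\subseteq\mathcal{M}_n(\mathbb{F})$ be subsets each of which contains all matrices of rank one and all idempotents of rank $n-1$. If a surjection $\Phi:\mathfrak{D}_1\to\mathfrak{D}_2$ strongly preserves the zeros of $\mathfrak{p}$, then there exist a field isomorphism $\varphi:\mathbb{F}\to\mathbb{F}$, a function $\gamma:\mathfrak{D}_1\setminus\{0\}\to\mathbb{F}\setminus\{0\}$, and an invertible matrix $T\in\mathcal{M}_n(\mathbb{F})$ such that (i) $\Phi(A)=\gamma(A)\,T A^{\varphi}T^{-1}$ for all rank-one matrices $A$, or (ii) $\Phi(A)=\gamma(A)\,T (A^{\varphi})^{\mathrm{tr}}T^{-1}$ for all rank-one matrices $A$.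
   Context: $\mathcal{M}_n(\mathbb{F})$ is the algebra of $n\times n$ matrices over $\mathbb{F}$; $\mathcal{S}_k$ is the set of all permutations of $\{1,\dots,k\}$. For matrices, $\mathfrak{p}(A_1,\dots,A_k)=\sum_{\sigma}\alpha_\sigma A_{\sigma(1)}\cdots A_{\sigma(k)}$. A map $\Phi:\mathfrak{D}_1\to\mathfrak{D}_2$ strongly preserves the zeros of $\mathfrak{p}$ if for all $A_1,\dots,A_k\in\mathfrak{D}_1$: $\mathfrak{p}(A_1,\dots,A_k)=0\Longleftrightarrow\mathfrak{p}(\Phi(A_1),\dots,\Phi(A_k))=0$. No linearity or additivity of $\Phi$ is assumed. $A^\varphi$ is the matrix obtained from $A$ by applying $\varphi$ entrywise, and $A^{\mathrm{tr}}$ is the transpose of $A$. *)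

(* Defs.v *)
From mathcomp Require Import all_boot all_algebra perm.
From mathcomp Require Import classical_sets functions.

Set Implicit Arguments.
Unset Strict Implicit.
Unset Printing Implicit Defensive.

Import GRing.Theory.

Local Open Scope classical_set_scope.
Local Open Scope ring_scope.

(* A multilinear polynomial in the noncommuting variables x_0, ..., x_(k-1) is
   given by its coefficient family alpha : 'S_k -> F; the product below is
   taken in increasing order of i, i.e. it is A (s 0) * ... * A (s (k-1)). *)
Definition mlpoly_eval (F : fieldType) (n k : nat) (alpha : 'S_k -> F)
    (A : 'I_k -> 'M[F]_n) : 'M[F]_n :=
  \sum_(s : 'S_k) alpha s *: \prod_(i < k) A (s i).

(* Only the values of Phi on D matter. *)
Definition strongly_preserves_zeros (F : fieldType) (n k : nat)
    (alpha : 'S_k -> F) (D : set 'M[F]_n) (Phi : 'M[F]_n -> 'M[F]_n) : Prop :=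
  forall A : 'I_k -> 'M[F]_n, (forall i, D (A i)) ->
    mlpoly_eval alpha A = 0 <-> mlpoly_eval alpha (fun i => Phi (A i)) = 0.

Definition idempotent_mx (F : fieldType) (n : nat) (A : 'M[F]_n) : Prop :=
  A *m A = A.

(* Main.v *)
(**
Only the relation Z(A, X) is used: p vanishes whenever A occupies one slot and
X all the others.  If X is idempotent then, because the coefficients of p sum
to a nonzero scalar, Z(A, X) means AX = XA = 0; together with p(A, ..., A) =
(sum of coefficients) A^k this shows that Phi respects nilpotency of rank-one
matrices.  For A of rank one with A^2 = tA, t != 0, the solutions of
Z(., 1 - A/t) are the multiples of A; conversely every nonzero solution space
of Z(., X) contains a rank-one matrix, built from common eigenvectors of left
and right multiplication by X.  Hence Phi maps rank-one matrices to rank-one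
matrices, and it preserves orthogonality AX = XA = 0 to non-nilpotent rank-one X.

Orthogonality detects when two rank-one matrices share their image or their
kernel, and these two kinds of lines are either all preserved or all exchanged;
the exchange is removed by a transposition.  So Phi(x f) is proportional to
psi(x) psi'(f), and f(x) = 0 iff psi'(f)(psi(x)) = 0 by nilpotency.  The
fundamental theorem of projective geometry is then proved in coordinates: after
a linear normalization, x_j = t x_i iff psi(x)_j = phi(t) psi(x)_i.
*)
Require Import Defs.
From HB Require Import structures.
From mathcomp Require Import all_boot all_algebra perm.
From mathcomp Require Import boolp classical_sets functions.
From mathcomp Require Import zify.

Set Implicit Arguments.
Unset Strict Implicit.
Unset Printing Implicit Defensive.

Import GRing.Theory.

Local Open Scope classical_set_scope.
Local Open Scope ring_scope.

(** * Rank-one matrices *)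

Section Proportional.
Variable F : fieldType.

Definition proportional m n (A B : 'M[F]_(m, n)) :=
  exists2 c : F, c != 0 & A = c *: B.

Lemma proportional_refl m n (A : 'M[F]_(m, n)) : proportional A A.
Proof. by exists 1; rewrite ?oner_neq0 ?scale1r. Qed.

Lemma proportional_sym m n (A B : 'M[F]_(m, n)) :
  proportional A B -> proportional B A.
Proof.
move=> [c c0 ->]; exists c^-1; first by rewrite invr_neq0.
by rewrite scalerA mulVf // scale1r.
Qed.

Lemma proportional_trans m n (A B C : 'M[F]_(m, n)) :
  proportional A B -> proportional B C -> proportional A C.
Proof.
move=> [c c0 ->] [d d0 ->]; exists (c * d); first by rewrite mulf_neq0.
by rewrite scalerA.
Qed.

Lemma proportional_tr m n (A B : 'M[F]_(m, n)) :
  proportional A^T B^T <-> proportional A B.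
Proof.
split=> - [c c0 E]; exists c => //; last by rewrite E linearZ.
by apply: trmx_inj; rewrite E linearZ.
Qed.

Lemma proportional_sub m n (A B : 'M[F]_(m, n)) :
  proportional A B -> (A <= B)%MS.
Proof. by move=> [c _ ->]; rewrite scalemx_sub. Qed.

Lemma proportional_mul m n p (A A' : 'M[F]_(m, n)) (B B' : 'M[F]_(n, p)) :
  proportional A A' -> proportional B B' -> proportional (A *m B) (A' *m B').
Proof.
move=> [c c0 ->] [d d0 ->]; exists (c * d); first by rewrite mulf_neq0.
by rewrite -scalemxAl -scalemxAr scalerA.
Qed.

End Proportional.

Section RankOne.
Variables (F : fieldType) (n : nat).
Implicit Types (x y z w : 'cV[F]_n) (f g h l : 'rV[F]_n) (A B C X : 'M[F]_n).

Definition orthogonal_mx A X := A *m X = 0 /\ X *m A = 0.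

Definition dot f x : F := (f *m x) 0 0.

Lemma dotE f x : f *m x = (dot f x)%:M.
Proof. by rewrite [LHS]mx11_scalar. Qed.

Lemma dotDl f g x : dot (f + g) x = dot f x + dot g x.
Proof. by rewrite /dot mulmxDl mxE. Qed.

Lemma dotDr f x y : dot f (x + y) = dot f x + dot f y.
Proof. by rewrite /dot mulmxDr mxE. Qed.

Lemma dotZl c f x : dot (c *: f) x = c * dot f x.
Proof. by rewrite /dot -scalemxAl mxE. Qed.

Lemma dotZr c f x : dot f (c *: x) = c * dot f x.
Proof. by rewrite /dot -scalemxAr mxE. Qed.

Lemma dot_tr f x : dot x^T f^T = dot f x.
Proof. by rewrite /dot -trmx_mul mxE. Qed.

Lemma mul_outer x f y g : x *m f *m (y *m g) = dot f y *: (x *m g).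
Proof.
by rewrite mulmxA -(mulmxA x) dotE mul_mx_scalar -scalemxAl.
Qed.

Lemma outer_eq0 x f : (x *m f == 0) = (x == 0) || (f == 0).
Proof.
apply/eqP/orP => [E|[/eqP->|/eqP->]]; rewrite ?mul0mx ?mulmx0 //.
have [x0|/matrix0Pn[i [j xi]]] := eqVneq x 0; first by left.
right; apply/eqP/matrixP=> a b; have/matrixP/(_ i b) := E.
rewrite (ord1 j) in xi; rewrite !mxE big_ord1 (ord1 a) => /eqP.
by rewrite mulf_eq0 (negbTE xi) /= => /eqP ->.
Qed.

Lemma rank_outer x f : x != 0 -> f != 0 -> \rank (x *m f) = 1%N.
Proof.
move=> x0 f0; apply/eqP; rewrite eqn_leq (leq_trans (mxrankM_maxl _ _)) ?rank_leq_col //.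
by rewrite lt0n mxrank_eq0 outer_eq0 negb_or x0.
Qed.

Lemma rank1P A : \rank A = 1%N ->
  exists x f, [/\ x != 0, f != 0 & A = x *m f].
Proof.
move=> rA; move: (mulmx_base A); move: (col_base A) (row_base A); rewrite rA => x f E.
exists x, f; have: x *m f != 0 by rewrite E -mxrank_eq0 rA.
by rewrite outer_eq0 negb_or => /andP[].
Qed.

Lemma proportional_sep f g : f != 0 -> g != 0 ->
  ~ proportional g f -> exists2 y, dot f y = 0 & dot g y != 0.
Proof.
move=> f0 g0 npar; have [/sub_rVP[c E]|] := boolP (g <= f)%MS.
  case: npar; exists c => //; apply: contraNneq g0 => c0.
  by rewrite E c0 scale0r.
rewrite submxE => /matrix0Pn[i [j]]; rewrite [i]ord1 => E.
exists (col j (cokermx f)); rewrite /dot colE mulmxA.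
  by rewrite mulmx_coker mul0mx mxE.
by rewrite -colE mxE.
Qed.

Lemma proportional_sepr x y : x != 0 -> y != 0 ->
  ~ proportional y x -> exists2 g, dot g x = 0 & dot g y != 0.
Proof.
move=> x0 y0 npar; have [|||z zx zy] := @proportional_sep x^T y^T.
- by rewrite trmx_eq0.
- by rewrite trmx_eq0.
- by move/proportional_tr.
- by exists z^T; rewrite -(trmxK x, trmxK y) dot_tr.
Qed.

Lemma dot_neq0 x : x != 0 -> exists f, dot f x != 0.
Proof.
move=> /matrix0Pn[i [j xi]]; exists (delta_mx 0 i).
by rewrite /dot -rowE mxE; rewrite (ord1 j) in xi.
Qed.

Lemma dot_neq0r f : f != 0 -> exists x, dot f x != 0.
Proof.
rewrite -trmx_eq0 => /dot_neq0[g]; exists g^T.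
by rewrite -(trmxK f) dot_tr.
Qed.

Lemma dot0l x : dot 0 x = 0. Proof. by rewrite /dot mul0mx mxE. Qed.

Lemma dot0r f : dot f 0 = 0. Proof. by rewrite /dot mulmx0 mxE. Qed.

(* A space is not the union of two proper subspaces. *)
Lemma dot_neq0_2 (P : 'rV[F]_n -> Prop) x y :
    (forall f g, P f -> P g -> P (f + g)) ->
    (exists2 f, P f & dot f x != 0) -> (exists2 g, P g & dot g y != 0) ->
  exists f, [/\ P f, dot f x != 0 & dot f y != 0].
Proof.
move=> PD [f Pf fx] [g Pg gy].
have [fy|fy] := eqVneq (dot f y) 0; last by exists f.
have [gx|gx] := eqVneq (dot g x) 0; last by exists g.
by exists (f + g); rewrite !dotDl fy gx addr0 add0r; split=> //; apply: PD.
Qed.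

Hypothesis n3 : (2 < n)%N.

(** Two equations in at least three unknowns: the cokernel of the stacked matrix of f and g is
    nonzero. *)
Lemma dot_eq0_2 f g : exists y, [/\ y != 0, dot f y = 0 & dot g y = 0].
Proof.
have : cokermx (col_mx f g) != 0.
  rewrite -mxrank_eq0 mxrank_coker -lt0n subn_gt0.
  exact: leq_ltn_trans (rank_leq_row _) n3.
move=> /matrix0Pn[i [j Eij]]; exists (col j (cokermx (col_mx f g))).
have := mulmx_coker (col_mx f g); rewrite mul_col_mx -col_mx0 => /eq_col_mx[Ef Eg].
split; first by apply/matrix0Pn; exists i, 0; rewrite mxE.
  by rewrite /dot colE mulmxA Ef mul0mx mxE.
by rewrite /dot colE mulmxA Eg mul0mx mxE.
Qed.

Lemma dot_eq0_2r x z : exists g, [/\ g != 0, dot g x = 0 & dot g z = 0].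
Proof.
have [y [y0 yx yz]] := dot_eq0_2 x^T z^T; exists y^T.
by rewrite trmx_eq0 -(trmxK x) -(trmxK z) !dot_tr.
Qed.

End RankOne.

(** * Zeros with all slots but one equal *)

Section Slot.
Variables (F : fieldType) (n k : nat) (alpha : 'S_k -> F).
Hypotheses (hk : (2 <= k)%N) (halpha : \sum_(s : 'S_k) alpha s != 0).
Implicit Types (A B C X : 'M[F]_n).

Lemma mxscaleAl c A B : c *: A * B = c *: (A * B).
Proof. exact/esym/scalemxAl. Qed.

Lemma mxscaleAr c A B : A * (c *: B) = c *: (A * B).
Proof. exact/esym/scalemxAr. Qed.

Lemma mxexprZ c A m : (c *: A) ^+ m = c ^+ m *: A ^+ m.
Proof.
elim: m => [|m IH]; first by rewrite scale1r.
by rewrite !exprS IH mxscaleAl mxscaleAr scalerA.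
Qed.

Definition slot (j : 'I_k) A X (i : 'I_k) := if i == j then A else X.

(** This is the relation Z(A, X). Asking it for every slot j permits summation over j, after which
    the coefficients at a fixed position add up to the full coefficient sum. *)
Definition slot_zero A X := forall j, mlpoly_eval alpha (slot j A X) = 0.

(** When A stands for the variable j and X for all others, this is the total coefficient of the
    monomials with A at position m. *)
Definition slot_coef (j m : 'I_k) : F := \sum_(s : 'S_k | s m == j) alpha s.

Lemma prod_slot (m : 'I_k) A X :
  \prod_(i < k) (if i == m then A else X) = X ^+ m * A * X ^+ (k - m.+1).
Proof.
pose G i := if i == m :> nat then A else X.
rewrite (eq_bigr (fun i : 'I_k => G i)) // -(big_mkord xpredT G).
have mk := ltn_ord m; rewrite (big_cat_nat _ (ltnW mk)) //= (big_ltn mk) /G eqxx mulrA.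
congr (_ * _ * _).
  rewrite big_nat (eq_bigr (fun=> X)) -?big_nat; last first.
    by move=> i /andP[_ /ltn_eqF ->].
  by rewrite prodr_const_nat subn0.
rewrite big_nat (eq_bigr (fun=> X)) -?big_nat; last first.
  by move=> i /andP[/gtn_eqF -> _].
by rewrite prodr_const_nat.
Qed.

Lemma eval_slot (j : 'I_k) A X :
  mlpoly_eval alpha (slot j A X) =
    \sum_(m < k) slot_coef j m *: (X ^+ m * A * X ^+ (k - m.+1)).
Proof.
rewrite /mlpoly_eval (partition_big (fun s : 'S_k => (s^-1)%g j) xpredT) //=.
apply: eq_bigr => m _; rewrite scaler_suml; apply: eq_big => s.
  by apply/eqP/eqP => [<-|<-]; rewrite ?permKV ?permK.
move=> /eqP sm; rewrite -prod_slot; congr (_ *: _); apply: eq_bigr => i _.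
by rewrite /slot -sm -[i == _](inj_eq (@perm_inj _ s)) permKV.
Qed.

Lemma sum_slot_coef_pos (j : 'I_k) : \sum_(m < k) slot_coef j m = \sum_s alpha s.
Proof.
rewrite [RHS](partition_big (fun s : 'S_k => (s^-1)%g j) xpredT) //=.
apply: eq_bigr => m _; apply: eq_bigl => s.
by apply/eqP/eqP => [<-|<-]; rewrite ?permKV ?permK.
Qed.

Lemma sum_slot_coef (m : 'I_k) : \sum_(j < k) slot_coef j m = \sum_s alpha s.
Proof. by rewrite [RHS](partition_big (fun s : 'S_k => s m) xpredT). Qed.

Lemma slot_zeroZ c A X : slot_zero A X -> slot_zero (c *: A) X.
Proof.
move=> Z j; rewrite -[RHS](scaler0 _ c) -(Z j) !eval_slot scaler_sumr.
by apply: eq_bigr => m _; rewrite mxscaleAr mxscaleAl !scalerA mulrC.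
Qed.

Lemma slot_zeroZr c A X : slot_zero A X -> slot_zero A (c *: X).
Proof.
move=> Z j; rewrite -[RHS](scaler0 _ (c ^+ k.-1)) -(Z j) !eval_slot scaler_sumr.
apply: eq_bigr => m _; rewrite !mxexprZ.
rewrite mxscaleAl mxscaleAr mxscaleAl !scalerA; congr (_ *: _).
rewrite -mulrA -exprD mulrC; congr (c ^+ _ * _).
by have := ltn_ord m; lia.
Qed.

(** C passes through the powers of X to the left of A. With C = X - r this makes the solutions of
    Z(., X) a space in which eigenvectors can be sought. *)
Lemma slot_zeroM C A X : C * X = X * C -> slot_zero A X -> slot_zero (C * A) X.
Proof.
move=> CX Z j; rewrite -[RHS](mulr0 C) -(Z j) !eval_slot mulr_sumr.
apply: eq_bigr => m _; have E : X ^+ m * C = C * X ^+ m by apply/esym/commrX.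
by rewrite mxscaleAr !mulrA E.
Qed.

Lemma slot_zeroMr C A X : C * X = X * C -> slot_zero A X -> slot_zero (A * C) X.
Proof.
move=> CX Z j; rewrite -[RHS](mul0r C) -(Z j) !eval_slot mulr_suml.
apply: eq_bigr => m _; have E : C * X ^+ (k - m.+1) = X ^+ (k - m.+1) * C by apply: commrX.
by rewrite mxscaleAl -!mulrA E.
Qed.

Lemma slot_zero_orth A X : orthogonal_mx A X -> slot_zero A X.
Proof.
move=> [AX XA] j; rewrite eval_slot big1 // => m _.
have [m0|m0] := posnP m; last first.
  rewrite -(prednK m0) exprSr -(mulrA _ X A) [X * A]XA.
  by rewrite mulr0 mul0r scaler0.
rewrite m0 mul1r subn1 -(ltn_predK (m := 0) (n := k.-1)) ?exprS.
  by rewrite mulrA [A * X]AX mul0r scaler0.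
by rewrite -ltnS prednK // ltnW.
Qed.

(** Multiplying by X on both sides turns every monomial into X A X, so X A X = 0. Multiplying on the
    right only then leaves the position with A in front, and summing over the slots gives the
    coefficient sum times A X. The argument for X A is symmetric, with A at the end. *)
Lemma idem_slot_zero A X : X *m X = X -> slot_zero A X -> orthogonal_mx A X.
Proof.
move=> XX Z.
have XXn m : (0 < m)%N -> X ^+ m = X.
  by case: m => // m _; elim: m => // m IH; rewrite exprS IH [X * X]XX.
have XnX m : X ^+ m * X = X by rewrite -exprSr XXn.
have XXn' m : X * X ^+ m = X by rewrite -exprS XXn.
have k0 : (0 < k)%N by apply: ltnW.
have XAX : X * A * X = 0.
  have : \sum_(m < k) slot_coef (Ordinal k0) m *: (X * A * X) = 0.
    transitivity (X * mlpoly_eval alpha (slot (Ordinal k0) A X) * X); last first.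
      by rewrite Z mulr0 mul0r.
    rewrite eval_slot mulr_sumr mulr_suml.
    apply: eq_bigr => m _; rewrite mxscaleAr mxscaleAl !mulrA XXn'.
    by rewrite -(mulrA (X * A)) XnX.
  rewrite -scaler_suml sum_slot_coef_pos => /eqP.
  by rewrite scaler_eq0 (negbTE halpha) => /eqP.
split.
  have : \sum_(j < k) slot_coef j (Ordinal k0) *: (A * X) = 0.
    transitivity (\sum_(j < k) mlpoly_eval alpha (slot j A X) * X); last first.
      by rewrite big1 // => j _; rewrite Z mul0r.
    apply: eq_bigr => j _; rewrite eval_slot (bigD1 (Ordinal k0)) //= mulrDl.
    rewrite mulr_suml big1 ?addr0; last first.
      move=> m m0; rewrite mxscaleAl -mulrA XnX XXn ?XAX ?scaler0 //.
      by rewrite lt0n; apply: contraNneq m0 => m0; apply/eqP/val_inj.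
    by rewrite mxscaleAl mul1r -mulrA XnX.
  rewrite -scaler_suml sum_slot_coef => /eqP.
  by rewrite scaler_eq0 (negbTE halpha) => /eqP.
have k1 : (k.-1 < k)%N by rewrite prednK.
have : \sum_(j < k) slot_coef j (Ordinal k1) *: (X * A) = 0.
  transitivity (\sum_(j < k) X * mlpoly_eval alpha (slot j A X)); last first.
    by rewrite big1 // => j _; rewrite Z mulr0.
  apply: eq_bigr => j _; rewrite eval_slot (bigD1 (Ordinal k1)) //= mulrDr.
  rewrite mulr_sumr big1 ?addr0; last first.
    move=> m m0; rewrite mxscaleAr !mulrA XXn' XXn ?XAX ?scaler0 //.
    rewrite subn_gt0 ltn_neqAle ltn_ord andbT.
    by apply: contraNneq m0 => m0; apply/eqP/val_inj => /=; lia.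
  by rewrite mxscaleAr !mulrA XXn' prednK // subnn mulr1.
rewrite -scaler_suml sum_slot_coef => /eqP.
by rewrite scaler_eq0 (negbTE halpha) => /eqP.
Qed.

Lemma quasi_idem_slot_zero t A X :
  t != 0 -> X *m X = t *: X -> slot_zero A X -> orthogonal_mx A X.
Proof.
move=> t0 XX /(slot_zeroZr t^-1) /idem_slot_zero [].
  by rewrite -scalemxAl -scalemxAr XX (scalerA _ t) mulVf // scale1r.
rewrite /orthogonal_mx -scalemxAr -scalemxAl.
move=> /eqP; rewrite scaler_eq0 invr_eq0 (negbTE t0) => /eqP -> /eqP.
by rewrite scaler_eq0 invr_eq0 (negbTE t0) => /eqP ->.
Qed.

Lemma eval_const A : mlpoly_eval alpha (fun=> A) = (\sum_s alpha s) *: A ^+ k.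
Proof.
by rewrite scaler_suml; apply: eq_bigr => s _; rewrite prodr_const card_ord.
Qed.

Lemma eval_const_eq0 A : mlpoly_eval alpha (fun=> A) = 0 <-> A ^+ k = 0.
Proof.
rewrite eval_const; split => [/eqP|->]; last by rewrite scaler0.
by rewrite scaler_eq0 (negbTE halpha) => /eqP.
Qed.

(** On a two-sided eigenvector with eigenvalues lambda and mu each monomial acts as a scalar
    depending only on lambda, mu and the position, so vanishing at one nonzero such matrix makes the
    total scalar 0. *)
Lemma slot_zero_eigen A X B (lambda mu : F) :
    A != 0 -> X *m A = lambda *: A -> A *m X = mu *: A -> slot_zero A X ->
  X *m B = lambda *: B -> B *m X = mu *: B -> slot_zero B X.
Proof.
move=> A0 XA AX Z XB BX j.
have pow (C : 'M[F]_n) : X *m C = lambda *: C -> C *m X = mu *: C ->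
    mlpoly_eval alpha (slot j C X) =
    (\sum_(m < k) slot_coef j m * (lambda ^+ m * mu ^+ (k - m.+1))) *: C.
  move=> XC CX; rewrite eval_slot scaler_suml; apply: eq_bigr => m _.
  rewrite -scalerA; congr (_ *: _).
  have -> : X ^+ m * C = lambda ^+ m *: C.
    elim: (val m) => [|p IH]; first by rewrite mul1r scale1r.
    by rewrite exprSr -mulrA [X * C]XC mxscaleAr IH scalerA -exprS.
  rewrite mxscaleAl -scalerA; congr (_ *: _).
  elim: (k - _)%N => [|p IH]; first by rewrite mulr1 scale1r.
  by rewrite exprS mulrA [C * X]CX mxscaleAl IH scalerA -exprS.
rewrite pow //; have/eqP := Z j; rewrite pow // scaler_eq0 (negbTE A0) orbF.
by move=> /eqP ->; rewrite scale0r.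
Qed.

End Slot.

(** * Orthogonality to non-nilpotent rank-one matrices *)

Section RankOneOrthogonality.
Variables (F : fieldType) (n : nat).
Implicit Types (x y z w : 'cV[F]_n) (f g h l : 'rV[F]_n) (A B C X : 'M[F]_n).

(** For A = x f one has A^2 = (f x) A, so within rank one a nonzero square means non-nilpotent, that
    is, a nonzero multiple of an idempotent. *)
Definition nonnil1 A := \rank A = 1%N /\ A *m A != 0.

Lemma nonnil1_outer x f : dot f x != 0 -> nonnil1 (x *m f).
Proof.
move=> fx; have x0 : x != 0 by apply: contraNneq fx => ->; rewrite dot0r.
have f0 : f != 0 by apply: contraNneq fx => ->; rewrite dot0l.
split; first exact: rank_outer.
by rewrite mul_outer scaler_eq0 outer_eq0 !negb_or fx x0.
Qed.

Lemma nonnil1P A : nonnil1 A ->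
  exists x f, [/\ x != 0, f != 0, A = x *m f & dot f x != 0].
Proof.
move=> [/rank1P[x [f [x0 f0 ->]]] AA]; exists x, f; split=> //.
by apply: contraNneq AA => fx; rewrite mul_outer fx scale0r.
Qed.

Lemma nonnil1_quasi A : nonnil1 A -> exists2 t, t != 0 & A *m A = t *: A.
Proof.
by move=> /nonnil1P[x [f [x0 f0 -> fx]]]; exists (dot f x); rewrite ?mul_outer.
Qed.

Lemma nonnil1_pow k A : (1 < k)%N -> \rank A = 1%N -> nonnil1 A <-> A ^+ k <> 0.
Proof.
move=> hk rA; have [x [f [x0 f0 E]]] := rank1P rA.
have AA : A *m A = dot f x *: A by rewrite E mul_outer.
have powE m : A ^+ m.+1 = dot f x ^+ m *: A.
  elim: m => [|m IH]; first by rewrite scale1r.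
  by rewrite exprS IH mxscaleAr [A * A]AA scalerA -exprSr.
rewrite -(prednK (ltnW hk)) powE; split=> [N|].
  have {N}[_] := N; rewrite AA scaler_eq0 negb_or => /andP[fx A0].
  by apply/eqP; rewrite scaler_eq0 negb_or expf_neq0.
move=> Ak; split=> //; apply: contra_notN Ak.
rewrite AA scaler_eq0 => /orP[/eqP->|/eqP->]; last exact: scaler0.
rewrite expr0n; have -> : (k.-1 == 0)%N = false by apply/negbTE; lia.
by rewrite scale0r.
Qed.

Lemma orthogonal_outer x f y g : x != 0 -> f != 0 -> y != 0 -> g != 0 ->
  orthogonal_mx (x *m f) (y *m g) <-> dot f y = 0 /\ dot g x = 0.
Proof.
move=> x0 f0 y0 g0; rewrite /orthogonal_mx !mul_outer; split.
  move=> [/eqP + /eqP]; rewrite !scaler_eq0 !outer_eq0.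
  by rewrite (negbTE x0) (negbTE f0) (negbTE y0) (negbTE g0) !orbF => /eqP-> /eqP->.
by move=> [-> ->]; rewrite !scale0r.
Qed.

Lemma orthogonal_tr A X : orthogonal_mx A^T X^T <-> orthogonal_mx A X.
Proof.
by rewrite /orthogonal_mx -!trmx_mul -trmx0; split=> [[/trmx_inj-> /trmx_inj->]|[-> ->]];
  rewrite ?trmx0.
Qed.

Lemma nonnil1_tr A : nonnil1 A^T <-> nonnil1 A.
Proof. by rewrite /nonnil1 mxrank_tr -trmx_mul trmx_eq0. Qed.

(** Sylvester's rank inequality bounds the rank from above, subadditivity from below. *)
Lemma idempotent_compl x f : dot f x = 1 ->
  idempotent_mx (1%:M - x *m f) /\ \rank (1%:M - x *m f) = n.-1.
Proof.
move=> fx; have x0 : x != 0.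
  by apply: contraPneq fx => ->; rewrite dot0r => /esym/eqP; rewrite oner_eq0.
have f0 : f != 0.
  by apply: contraPneq fx => ->; rewrite dot0l => /esym/eqP; rewrite oner_eq0.
have E : x *m f *m (1%:M - x *m f) = 0.
  by rewrite mulmxBr mul_outer fx scale1r mulmx1 subrr.
split; first by rewrite /idempotent_mx mulmxBl E mul1mx subr0.
apply/eqP; rewrite eqn_leq; apply/andP; split.
  have := mxrank_mul_min (x *m f) (1%:M - x *m f).
  by rewrite E mxrank0 rank_outer // => ?; lia.
have := mxrank_add (x *m f) (1%:M - x *m f).
by rewrite addrC subrK mxrank1 rank_outer //; lia.
Qed.

Hypothesis n3 : (2 < n)%N.

(** For y in the kernel of f and off the line of x, some g kills x but not y; then y g is
    non-nilpotent and orthogonal to x f, so B y g = 0. *)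
Lemma orthogonal_ker x f B : x != 0 -> f != 0 ->
    (forall X, nonnil1 X -> orthogonal_mx (x *m f) X -> orthogonal_mx B X) ->
  forall y, dot f y = 0 -> B *m y = 0.
Proof.
move=> x0 f0 BX.
have Bnpar y : y != 0 -> ~ proportional y x -> dot f y = 0 -> B *m y = 0.
  move=> y0 yx fy; have [g gx gy] := proportional_sepr x0 y0 yx.
  have g0 : g != 0 by apply: contraNneq gy => ->; rewrite dot0l.
  have [] := BX _ (nonnil1_outer gy); first exact/orthogonal_outer.
  by move=> /eqP; rewrite mulmxA outer_eq0 (negbTE g0) orbF => /eqP.
move=> y fy; have [->|y0] := eqVneq y 0; first by rewrite mulmx0.
have [yx|] := pselect (proportional y x); last by move/Bnpar->.
(* Here y lies on the line of x. Take w in the kernel of f and off that line; w and w + y are both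
   covered by [Bnpar], and y is their difference. *)
have [g gx] := dot_neq0 x0; have [w [w0 fw gw]] := dot_eq0_2 n3 f g.
have wx : ~ proportional w x.
  by move=> [c c0 E]; move: gx; rewrite -(mulrI_eq0 _ (mulfI c0)) -dotZr -E gw eqxx.
have wyx : ~ proportional (w + y) x.
  move=> [c c0 E]; apply: wx; have [d d0 Ey] := yx.
  exists (c - d); last by rewrite scalerBl -E -Ey addrK.
  apply: contraNneq w0 => cd; have := scale0r x; rewrite -cd scalerBl -E -Ey addrK.
  by move=> ->; rewrite eqxx.
have wy0 : w + y != 0.
  apply/eqP=> E; apply: wx; apply: proportional_trans yx; exists (-1).
    by rewrite oppr_eq0 oner_neq0.
  by rewrite scaleN1r; apply/eqP; rewrite -subr_eq0 opprK E.
have := Bnpar _ wy0 wyx; rewrite dotDr fw fy addr0 mulmxDr => /(_ erefl).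
by rewrite Bnpar // add0r.
Qed.

(** The kernel of f lies in that of B, so B factors as D f; the same argument for transposes puts D
    on the line of x. *)
Lemma orthogonal_proportional A B : \rank A = 1%N -> B != 0 ->
  (forall X, nonnil1 X -> orthogonal_mx A X -> orthogonal_mx B X) ->
  proportional B A.
Proof.
move=> /rank1P[x [f [x0 f0 ->]]] B0 BX.
have kerB := orthogonal_ker x0 f0 BX.
have /submxP[D E] : (B <= f)%MS.
  rewrite submxE; move: (cokermx f) (mulmx_coker f) => K fK; apply/eqP/matrixP => i j.
  transitivity ((B *m col j K) i 0).
    by rewrite colE mulmxA -colE [RHS]mxE.
  by rewrite kerB ?mxE // /dot colE mulmxA fK mul0mx mxE.
have D0 : D != 0 by apply: contraNneq B0; rewrite E => ->; rewrite mul0mx.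
rewrite E; apply: proportional_mul; last exact: proportional_refl.
apply: contrapT => nDx; have [g gx gD] := proportional_sepr x0 D0 nDx.
have BTX X : nonnil1 X -> orthogonal_mx (f^T *m x^T) X -> orthogonal_mx B^T X.
  rewrite -[X]trmxK => /nonnil1_tr NX; rewrite -trmx_mul => /orthogonal_tr /(BX _ NX).
  by move/orthogonal_tr.
have fT0 : f^T != 0 by rewrite trmx_eq0.
have xT0 : x^T != 0 by rewrite trmx_eq0.
have gxT : dot x^T g^T = 0 by rewrite dot_tr.
have := orthogonal_ker fT0 xT0 BTX gxT.
move=> /eqP; rewrite -trmx_mul trmx_eq0 E mulmxA dotE mul_scalar_mx scaler_eq0.
by rewrite (negbTE gD) (negbTE f0).
Qed.

End RankOneOrthogonality.

(** By Cayley-Hamilton the product of the X - r over the roots r kills B. Multiplying B by the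
    factors one at a time, the last nonzero product is an eigenvector, and [V] is preserved on the
    way. *)
Lemma eigen_left (F : closedFieldType) n (X : 'M[F]_n.+1) (V : 'M[F]_n.+1 -> Prop) B :
    (forall r C, V C -> V ((X - r%:M) * C)) -> V B -> B != 0 ->
  exists C (lambda : F), [/\ V C, C != 0 & X *m C = lambda *: C].
Proof.
move=> VX; have [rs] := closed_field_poly_normal (char_poly X).
rewrite (monicP (char_poly_monic X)) scale1r => E.
have := Cayley_Hamilton X; rewrite {}E => CH.
have : horner_mx X (\prod_(z <- rs) ('X - z%:P)) * B = 0 by rewrite CH mul0r.
elim: rs B {CH} => [|r rs IH] B.
  by rewrite big_nil rmorph1 mul1r => -> _; rewrite eqxx.
rewrite big_cons mulrC rmorphM /= rmorphB /= horner_mx_X horner_mx_C -mulrA => E VB B0.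
have [C0|C0] := eqVneq ((X - r%:M) * B) 0; last exact: IH E (VX _ _ VB) C0.
exists B, r; split=> //; apply/eqP; rewrite -subr_eq0 -mul_scalar_mx -mulmxBl.
exact/eqP.
Qed.

(** The solutions of Z(., X) are stable under left and right multiplication by X, which commute. An
    eigenvector of the left one is found first, then, inside that eigenspace, one of the right one;
    a column times a row of it keeps both eigenvalues. *)
Lemma slot_zero_rank1 (F : closedFieldType) n k (alpha : 'S_k -> F) (B X : 'M[F]_n) :
    B != 0 -> slot_zero alpha B X ->
  exists2 C : 'M[F]_n, \rank C = 1%N & slot_zero alpha C X.
Proof.
case: n B X => [|n] B X; first by rewrite [B]flatmx0 eqxx.
move=> B0 ZB.
have comm r : (X - r%:M) * X = X * (X - r%:M).
  by rewrite mulrBl mulrBr; congr (_ - _); apply/esym/comm_mx_scalar.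
have [|C [lambda [ZC C0 XC]]] := @eigen_left F n X (fun M => slot_zero alpha M X) B _ ZB B0.
  by move=> r C; apply: slot_zeroM.
(* Right multiplication becomes left multiplication after transposition, so [V] is stated for the
   transpose of its argument. *)
pose V (M : 'M[F]_n.+1) := slot_zero alpha M^T X /\ X *m M^T = lambda *: M^T.
have [||| D [mu [[ZD XD] D0 DX]]] := @eigen_left F n X^T V C^T.
- move=> r M [ZM XM]; rewrite /V trmx_mul linearB /= trmxK tr_scalar_mx.
  by split; [apply: slot_zeroMr | rewrite mulmxA XM scalemxAl].
- by split; rewrite trmxK.
- by rewrite trmx_eq0.
rewrite -(inj_eq trmx_inj) trmx0 in D0.
have {}DX : D^T *m X = mu *: D^T by rewrite -[X]trmxK -trmx_mul DX linearZ.
move: {D}D^T ZD XD D0 DX => D ZD XD D0 DX.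
have [i [j Dij]] := matrix0Pn _ D0.
have cD : col j D != 0 by apply/matrix0Pn; exists i, 0; rewrite mxE.
have rD : row i D != 0 by apply/matrix0Pn; exists 0, j; rewrite mxE.
exists (col j D *m row i D); first exact: rank_outer.
apply: (slot_zero_eigen D0 XD DX ZD).
  by rewrite mulmxA colE mulmxA XD -!scalemxAl.
by rewrite -mulmxA rowE -[_ *m X]mulmxA DX -!scalemxAr.
Qed.

(** * Correspondences preserving the zero relation *)

Section ZeroRelation.
Variables (F : closedFieldType) (n k : nat) (alpha : 'S_k -> F).
Hypotheses (n3 : (2 < n)%N) (hk : (2 <= k)%N).
Hypothesis (halpha : \sum_(s : 'S_k) alpha s != 0).
Implicit Types (x y z w : 'cV[F]_n) (f g h l : 'rV[F]_n) (A B C X : 'M[F]_n).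

(** Phi is not assumed injective, so its graph is treated as a relation: this can be reversed, and
    every result then applies in both directions. *)
Definition zero_total (R : 'M[F]_n -> 'M[F]_n -> Prop) :=
  (forall A, \rank A = 1%N -> exists B, R A B) /\
  (forall A, idempotent_mx A /\ \rank A = n.-1 -> exists B, R A B).

Definition zero_preserving (R : 'M[F]_n -> 'M[F]_n -> Prop) :=
  (forall A B X Y, R A B -> R X Y -> slot_zero alpha A X <-> slot_zero alpha B Y) /\
  (forall A B, R A B -> A ^+ k = 0 <-> B ^+ k = 0).

Definition zero_correspondence R :=
  [/\ zero_total R, zero_total (fun A B => R B A) & zero_preserving R].

Lemma zero_correspondence_sym R :
  zero_correspondence R -> zero_correspondence (fun A B => R B A).
Proof.
move=> [RR RR' [RZ RN]]; split=> //; split=> [A B X Y AB XY|A B AB].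
  by rewrite (RZ _ _ _ _ AB XY).
by rewrite (RN _ _ AB).
Qed.

(** Z(0, X) holds for every X, so a partner B = z h of 0 would be orthogonal to all non-nilpotent
    rank-one matrices, including one y g with h y nonzero. *)
Lemma zero_correspondence_neq0 R A B : zero_correspondence R -> R A B ->
  \rank B = 1%N -> A != 0.
Proof.
move=> [_ [R1 _] [RZ _]] AB /rank1P[z [h [z0 h0 EB]]].
have [y hy] := dot_neq0r h0.
have y0 : y != 0 by apply: contraNneq hy => ->; rewrite dot0r.
have [g gy] := dot_neq0 y0.
have g0 : g != 0 by apply: contraNneq gy => ->; rewrite dot0l.
have [X XY] := R1 (y *m g) (rank_outer y0 g0).
apply: contraNneq hy => A0; apply/eqP.
have [t t0 YY] := nonnil1_quasi (nonnil1_outer gy).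
have /(quasi_idem_slot_zero hk halpha t0 YY) : slot_zero alpha B (y *m g).
  by apply/(RZ _ _ _ _ AB XY)/slot_zero_orth => //; rewrite A0 /orthogonal_mx mul0mx mulmx0.
by rewrite EB => /(orthogonal_outer z0 h0 y0 g0)[].
Qed.

Lemma slot_zero_proportional A B X :
  proportional A B -> slot_zero alpha A X <-> slot_zero alpha B X.
Proof.
move=> AB; split; last by have [c _ ->] := AB; exact: slot_zeroZ.
by have [c _ ->] := proportional_sym AB; exact: slot_zeroZ.
Qed.

Lemma slot_zero_orth_nonnil1 A X :
  nonnil1 X -> slot_zero alpha A X <-> orthogonal_mx A X.
Proof.
move=> /nonnil1_quasi[t t0 XX]; split; last exact: slot_zero_orth.
exact: quasi_idem_slot_zero XX.
Qed.

(** Z(A, .) is insensitive to scaling A, so B and B' are orthogonal to the same non-nilpotent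
    rank-one matrices. Only B' is known to have rank one; for B it follows. *)
Lemma zero_correspondence_proportional R A A' B B' : zero_correspondence R ->
  R A B -> R A' B' -> proportional A A' -> B != 0 -> \rank B' = 1%N ->
  proportional B B'.
Proof.
move=> [_ [R1 _] [RZ _]] AB AB' AA' B0 rB'; apply: (orthogonal_proportional n3) => // Y NY.
have [X XY] := R1 Y (proj1 NY).
rewrite -!slot_zero_orth_nonnil1 // -(RZ _ _ _ _ AB XY) -(RZ _ _ _ _ AB' XY).
by move/(slot_zero_proportional _ AA').
Qed.

(** The idempotent P = 1 - A/t, with A^2 = tA, satisfies Z(A, P), and Z(., P) holds only on the line
    of A. A rank-one solution for the partner of P therefore comes from a multiple of A, which
    forces B to have rank one. Non-nilpotency is then read off from the k-th powers. *)
Lemma zero_correspondence_nonnil1 R A B :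
  zero_correspondence R -> R A B -> nonnil1 A -> nonnil1 B.
Proof.
move=> RC AB NA; have [[R1 Ri] [R1' _] [RZ RN]] := RC.
have [x [f [x0 f0 EA fx]]] := nonnil1P NA.
have rA := proj1 NA.
have B0 : B != 0.
  move/(nonnil1_pow hk rA): NA; apply: contra_notN => /eqP B0.
  by apply/(RN _ _ AB); rewrite B0 expr0n; have -> : (k == 0)%N = false by apply/negbTE; lia.
have fx1 : dot f ((dot f x)^-1 *: x) = 1 by rewrite dotZr mulVf.
have [Pid rP] := idempotent_compl fx1.
have [Q PQ] := Ri _ (conj Pid rP).
have AP : orthogonal_mx A (1%:M - (dot f x)^-1 *: x *m f).
  rewrite /orthogonal_mx EA mulmxBl mulmxBr mulmx1 mul1mx !mul_outer fx1 scale1r subrr.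
  by rewrite -!scalemxAl scalerA divff // scale1r subrr.
have /(slot_zero_rank1 B0) [C rC CQ] : slot_zero alpha B Q.
  exact/(RZ _ _ _ _ AB PQ)/slot_zero_orth.
have [A' A'C] := R1' _ rC.
have [] : orthogonal_mx A' (1%:M - (dot f x)^-1 *: x *m f).
  by apply: (idem_slot_zero hk halpha) Pid _; apply/(RZ _ _ _ _ A'C PQ).
rewrite mulmxBr mulmx1 mulmxBl mul1mx => /eqP + /eqP.
rewrite !subr_eq0 => /eqP AP1 /eqP AP2.
have A'0 := zero_correspondence_neq0 RC A'C rC.
have A'A : proportional A' A.
  have [c E] : exists c, A' = c *: A.
    set e := (dot f x)^-1 *: x in AP1 AP2.
    (* A' P = P A' = 0 gives A' = (e f) A' (e f), a scalar multiple of e f = A/t. *)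
    have E : A' = e *m f *m (A' *m (e *m f)) by rewrite -AP1 -AP2.
    exists (dot f (A' *m e) * (dot f x)^-1).
    by rewrite {1}E (mulmxA A') mul_outer /e -scalemxAl scalerA EA.
  by exists c => //; apply: contraNneq A'0 => c0; rewrite E c0 scale0r.
have BC : proportional B C.
  exact: (zero_correspondence_proportional RC AB A'C (proportional_sym A'A)).
have rB : \rank B = 1%N by have [c c0 ->] := BC; rewrite mxrank_scale_nz.
apply/(nonnil1_pow hk) => // Bk; move/(nonnil1_pow hk rA): NA; apply.
exact/(RN _ _ AB).
Qed.

(* The rank-one matrix B' = (column of B) (row of B) is orthogonal to everything
   that B is orthogonal to, so its preimage is proportional to A. *)
Lemma zero_correspondence_rank1 R A B :
  zero_correspondence R -> R A B -> \rank A = 1%N -> \rank B = 1%N.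
Proof.
move=> RC AB rA; have [[R1 Ri] [R1' _] [RZ RN]] := RC.
have B0 : B != 0 by apply: zero_correspondence_neq0 (zero_correspondence_sym RC) AB rA.
have [i [j Bij]] := matrix0Pn _ B0.
have cB : col j B != 0 by apply/matrix0Pn; exists i, 0; rewrite mxE.
have rB : row i B != 0 by apply/matrix0Pn; exists 0, j; rewrite mxE.
have rB' := rank_outer cB rB; have [A' AB'] := R1' _ rB'.
have BB' Y : orthogonal_mx B Y -> orthogonal_mx (col j B *m row i B) Y.
  move=> [BY YB]; split; first by rewrite -mulmxA rowE -(mulmxA _ B) BY !mulmx0.
  by rewrite mulmxA colE (mulmxA Y) YB !mul0mx.
have A'0 := zero_correspondence_neq0 RC AB' rB'.
have A'A : proportional A' A.
  apply: (orthogonal_proportional n3) => // X NX; have [Y XY] := R1 _ (proj1 NX).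
  have NY := zero_correspondence_nonnil1 RC XY NX.
  rewrite -!slot_zero_orth_nonnil1 // (RZ _ _ _ _ AB XY) (RZ _ _ _ _ AB' XY).
  by rewrite !slot_zero_orth_nonnil1 //; exact: BB'.
have [c c0 ->] := zero_correspondence_proportional RC AB AB' (proportional_sym A'A) B0 rB'.
by rewrite mxrank_scale_nz.
Qed.

End ZeroRelation.

(** * Maps preserving orthogonality of rank-one matrices *)

Section RankOneMaps.
Variables (F : fieldType) (n : nat).
Hypothesis n3 : (2 < n)%N.
Implicit Types (x y z w : 'cV[F]_n) (f g h l : 'rV[F]_n) (A B C X : 'M[F]_n).
Implicit Types (Phi : 'M[F]_n -> 'M[F]_n).

(** For rank-one matrices the inclusion is an equality: [same_row] means equal kernels and
    [same_col] equal images. *)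
Definition same_row A B := (A <= B)%MS.
Definition same_col A B := (A^T <= B^T)%MS.

Lemma same_row_outer x f z h : x != 0 -> f != 0 -> z != 0 -> h != 0 ->
  same_row (x *m f) (z *m h) <-> proportional f h.
Proof.
move=> x0 f0 z0 h0.
have full (v : 'cV[F]_n) : v != 0 -> row_full v.
  move=> v0; rewrite /row_full eqn_leq rank_leq_col lt0n mxrank_eq0 v0 //.
rewrite /same_row (eqmxMfull _ (full _ x0)) (eqmxMfull _ (full _ z0)).
split=> [/sub_rVP[c E]|]; last exact: proportional_sub.
by exists c => //; apply: contraNneq f0 => c0; rewrite E c0 scale0r.
Qed.

Lemma same_col_outer x f z h : x != 0 -> f != 0 -> z != 0 -> h != 0 ->
  same_col (x *m f) (z *m h) <-> proportional x z.
Proof.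
move=> x0 f0 z0 h0; rewrite -proportional_tr /same_col !trmx_mul.
by apply: same_row_outer; rewrite trmx_eq0.
Qed.

Lemma same_row_sym A B : \rank A = 1%N -> \rank B = 1%N ->
  same_row A B -> same_row B A.
Proof.
move=> /rank1P[x [f [x0 f0 ->]]] /rank1P[z [h [z0 h0 ->]]].
by rewrite !same_row_outer //; apply: proportional_sym.
Qed.

Lemma same_col_sym A B : \rank A = 1%N -> \rank B = 1%N ->
  same_col A B -> same_col B A.
Proof. by move=> rA rB; apply: same_row_sym; rewrite mxrank_tr. Qed.

Lemma same_col_row A B : \rank A = 1%N -> \rank B = 1%N ->
  same_col A B -> same_row A B -> proportional A B.
Proof.
move=> /rank1P[x [f [x0 f0 ->]]] /rank1P[z [h [z0 h0 ->]]].
by rewrite same_row_outer // same_col_outer //; apply: proportional_mul.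
Qed.

Lemma proportional_same_row A B : proportional A B -> same_row A B.
Proof. exact: proportional_sub. Qed.

Lemma proportional_same_col A B : proportional A B -> same_col A B.
Proof. by move/proportional_tr/proportional_sub. Qed.

Definition adjacent A B := same_col A B \/ same_row A B.

(* For A = x f with f x != 0, this expresses that the double orthogonal of {A, B}
   is a line of rank-one matrices: when B = z h is in general position, C = x h
   violates it. *)
Definition adjacency_criterion A B := forall C, \rank C = 1%N -> ~ proportional C A ->
  (forall X, nonnil1 X -> orthogonal_mx A X -> orthogonal_mx B X -> orthogonal_mx C X) ->
  forall X, nonnil1 X -> orthogonal_mx A X -> orthogonal_mx C X -> orthogonal_mx B X.

Lemma adjacency_criterion_tr A B :
  adjacency_criterion A B -> adjacency_criterion A^T B^T.
Proof.
move=> AB C rC CA ABC X NX.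
move=> AX CX; have {}AX : orthogonal_mx A X^T by rewrite -orthogonal_tr trmxK.
apply/orthogonal_tr; rewrite trmxK.
apply: (AB C^T _ _ _ X^T) => //; rewrite ?mxrank_tr ?nonnil1_tr ?orthogonal_tr //.
  by rewrite -proportional_tr trmxK.
move=> Y NY AY BY; rewrite -orthogonal_tr trmxK; apply: ABC.
- by rewrite nonnil1_tr.
- by rewrite orthogonal_tr.
- by rewrite orthogonal_tr.
Qed.

(** An X = y g orthogonal to both matrices has f y = 0 and g x = g z = 0. If C = w l is orthogonal
    to all these, then l is proportional to f and w lies in the span of x and z. As w is not on the
    line of x, any form killing x and w kills z. *)
Lemma same_row_criterion x z f : dot f x != 0 -> z != 0 ->
  adjacency_criterion (x *m f) (z *m f).
Proof.
move=> fx z0.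
have x0 : x != 0 by apply: contraNneq fx => ->; rewrite dot0r.
have f0 : f != 0 by apply: contraNneq fx => ->; rewrite dot0l.
move=> C /rank1P[w [l [w0 l0 ->]]] nCA S.
have {}S y g : dot g y != 0 -> dot f y = 0 -> dot g x = 0 -> dot g z = 0 ->
    dot l y = 0 /\ dot g w = 0.
  move=> gy fy gx gz; have y0 : y != 0 by apply: contraNneq gy => ->; rewrite dot0r.
  have g0 : g != 0 by apply: contraNneq gy => ->; rewrite dot0l.
  by apply/orthogonal_outer => //; apply: S (nonnil1_outer gy) _ _; apply/orthogonal_outer.
have ker g : g != 0 -> dot g x = 0 -> exists2 y, dot f y = 0 & dot g y != 0.
  move=> g0 gx; apply: proportional_sep => // -[c c0 E].
  by move: gx; rewrite E dotZl => /eqP; rewrite mulf_eq0 (negbTE c0) (negbTE fx).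
have [g [g0 gx gz]] := dot_eq0_2r n3 x z.
have lf : proportional l f.
  apply: contrapT => /(proportional_sep f0 l0) [y fy ly].
  have [y1 fy1 gy1] := ker _ g0 gx.
  have [ly1 _] := S _ _ gy1 fy1 gx gz.
  have [gy|gy] := eqVneq (dot g y) 0; last first.
    by have [ly0 _] := S _ _ gy fy gx gz; move: ly; rewrite ly0 eqxx.
  (* Here g vanishes at y, so y is shifted by y1, on which f and l vanish but g does not. *)
  have [] : dot l (y + y1) = 0 /\ dot g w = 0.
    by apply: S; rewrite // dotDr ?gy ?add0r ?fy ?fy1 ?addr0.
  by rewrite dotDr ly1 addr0 => ly0; move: ly; rewrite ly0 eqxx.
have gw0 h : dot h x = 0 -> dot h z = 0 -> dot h w = 0.
  have [->|h0] := eqVneq h 0; first by rewrite !dot0l.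
  by move=> hx hz; have [y fy hy] := ker _ h0 hx; have [] := S _ _ hy fy hx hz.
have wx : ~ proportional w x.
  by move=> wx; apply: nCA; apply: proportional_mul.
move=> X /nonnil1P[y [h [y0 h0 -> hy]]].
rewrite !orthogonal_outer // => -[fy hx] [ly hw]; split=> //.
have [g1 g1x g1w] := proportional_sepr x0 w0 wx.
(* This combination of g1 and h kills x and z, hence w; since g1 w is nonzero and h w = 0, it
   follows that h z = 0. *)
have := gw0 (dot h z *: g1 - dot g1 z *: h).
rewrite -!scaleNr !dotDl !dotZl g1x hx !mulr0 addr0 hw mulr0 addr0 => /(_ erefl).
rewrite mulNr mulrC subrr => /(_ erefl) /eqP.
by rewrite mulf_eq0 (negbTE g1w) orbF => /eqP.
Qed.

Lemma adjacentP A B : nonnil1 A -> \rank B = 1%N ->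
  adjacent A B <-> adjacency_criterion A B.
Proof.
move=> /nonnil1P[x [f [x0 f0 -> fx]]] /rank1P[z [h [z0 h0 ->]]].
rewrite /adjacent same_col_outer // same_row_outer //; split; last first.
  move=> crit; apply: contrapT => /not_orP [xz fh].
  (* The violation by C = x h: X = y g will be orthogonal to A and C but, as g z is nonzero, not to
     B = z h. *)
  have [y [y0 fy hy]] := dot_eq0_2 n3 f h.
  have yx : ~ proportional y x.
    by move=> [c c0 E]; move/eqP: fy; rewrite E dotZr mulf_eq0 (negbTE c0) (negbTE fx).
  have zx : ~ proportional z x by move/proportional_sym.
  have [|||g [gx gy gz]] := @dot_neq0_2 _ _ (fun g => dot g x = 0) y z.
  - by move=> g1 g2 E1 E2; rewrite dotDl E1 E2 addr0.
  - by have [g] := proportional_sepr x0 y0 yx; exists g.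
  - by have [g] := proportional_sepr x0 z0 zx; exists g.
  have g0 : g != 0 by apply: contraNneq gy => ->; rewrite dot0l.
  have npar : ~ proportional (x *m h) (x *m f).
    move/proportional_same_row/(same_row_outer x0 h0 x0 f0).
    by move/proportional_sym.
  have S X : nonnil1 X -> orthogonal_mx (x *m f) X -> orthogonal_mx (z *m h) X ->
      orthogonal_mx (x *m h) X.
    move=> /nonnil1P[y' [g' [y'0 g'0 -> _]]].
    by rewrite !orthogonal_outer // => -[? ?] [? ?].
  have := crit _ (rank_outer x0 h0) npar S _ (nonnil1_outer gy).
  move=> /(_ (proj2 (orthogonal_outer x0 f0 y0 g0) (conj fy gx))).
  move=> /(_ (proj2 (orthogonal_outer x0 h0 y0 g0) (conj hy gx))).
  by move=> /(orthogonal_outer z0 h0 y0 g0) [_ /eqP]; rewrite (negbTE gz).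
move=> [/proportional_sym[c c0 ->]|/proportional_sym[c c0 ->]]; last first.
  rewrite -scalemxAr scalemxAl; apply: same_row_criterion => //.
  by rewrite scaler_eq0 negb_or c0.
rewrite -scalemxAl scalemxAr -(trmxK (x *m f)) -(trmxK (x *m (c *: h))).
apply: adjacency_criterion_tr; rewrite !trmx_mul.
apply: same_row_criterion; first by rewrite dot_tr.
by rewrite trmx_eq0 scaler_eq0 negb_or c0.
Qed.

Definition rank1_iso Phi :=
  [/\ forall A, \rank A = 1%N -> \rank (Phi A) = 1%N,
      forall B, \rank B = 1%N -> exists2 A, \rank A = 1%N & Phi A = B,
      forall A, \rank A = 1%N -> nonnil1 A <-> nonnil1 (Phi A)
    & forall A X, \rank A = 1%N -> nonnil1 X ->
        orthogonal_mx A X <-> orthogonal_mx (Phi A) (Phi X)].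

Lemma rank1_iso_tr Phi : rank1_iso Phi -> rank1_iso (fun A => (Phi A)^T).
Proof.
move=> [r s N o]; split=> [A rA|B rB|A rA|A X rA NX].
- by rewrite mxrank_tr r.
- have [|A rA E] := s B^T; first by rewrite mxrank_tr.
  by exists A; rewrite // E trmxK.
- by rewrite nonnil1_tr N.
- by rewrite orthogonal_tr o.
Qed.

Lemma rank1_iso_pretr Phi : rank1_iso Phi -> rank1_iso (fun A => Phi A^T).
Proof.
move=> [r s N o]; split=> [A rA|B rB|A rA|A X rA NX].
- by rewrite r ?mxrank_tr.
- have [A rA E] := s B rB.
  by exists A^T; rewrite ?trmxK ?mxrank_tr.
- by rewrite -nonnil1_tr N // mxrank_tr.
- by rewrite -orthogonal_tr o ?mxrank_tr ?nonnil1_tr.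
Qed.

Lemma orthogonal_proportionall A B X :
  proportional A B -> orthogonal_mx A X -> orthogonal_mx B X.
Proof.
move=> /proportional_sym[c c0 ->] [AX XA].
by rewrite /orthogonal_mx -scalemxAl -scalemxAr AX XA scaler0.
Qed.

Lemma rank1_neq0 A : \rank A = 1%N -> A != 0.
Proof. by rewrite -mxrank_eq0 => ->. Qed.

Section Iso.
Variable Phi : 'M[F]_n -> 'M[F]_n.
Hypothesis iso : rank1_iso Phi.

Lemma iso_rank A : \rank A = 1%N -> \rank (Phi A) = 1%N.
Proof. by have [r _ _ _] := iso; apply: r. Qed.

Lemma iso_surj_nonnil1 Y : nonnil1 Y -> exists2 X, nonnil1 X & Phi X = Y.
Proof.
have [r s N o] := iso; move=> NY; have [X rX E] := s Y (proj1 NY).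
by exists X => //; apply/N => //; rewrite E.
Qed.

Lemma iso_proportional A B : \rank A = 1%N -> \rank B = 1%N ->
  proportional A B <-> proportional (Phi A) (Phi B).
Proof.
have [r s N o] := iso => rA rB; split=> AB.
  apply: orthogonal_proportional => //; first exact: r.
    by apply: rank1_neq0; apply: r.
  move=> Y /iso_surj_nonnil1[X NX <-]; rewrite -!o //.
  exact: orthogonal_proportionall (proportional_sym AB).
apply: orthogonal_proportional => //; first exact: rank1_neq0.
move=> X NX; rewrite (o A) // (o B) //.
exact: orthogonal_proportionall (proportional_sym AB).
Qed.

(** [adjacency_criterion] speaks only of rank one, proportionality and orthogonality, all of which
    Phi preserves and reflects; surjectivity moves the quantifiers across. *)
Lemma iso_adjacent A B : nonnil1 A -> \rank B = 1%N ->
  adjacent A B <-> adjacent (Phi A) (Phi B).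
Proof.
move=> NA rB; have [r s N o] := iso; have rA := proj1 NA.
rewrite !adjacentP //; [|by rewrite -N|exact: r].
split=> crit C rC CA S.
  have [C' rC' EC] := s C rC; rewrite -{}EC in CA S *.
  move=> Y /iso_surj_nonnil1[X NX <-]; rewrite -!o //.
  apply: crit => //; first by rewrite iso_proportional.
  by move=> Z NZ; rewrite (o A) // (o B) // (o C') //; apply: S; apply/(N _ (proj1 NZ)).
move=> X NX; rewrite (o A) // (o B) // (o C) //; apply: (crit (Phi C)).
- exact: r.
- by rewrite -iso_proportional.
- by move=> Y /iso_surj_nonnil1[Z NZ <-]; rewrite -!o //; apply: S.
- exact/(N _ (proj1 NX)).
Qed.

(** The lines through A are the families of rank-one matrices sharing its image, or its kernel. The
    case in which Phi exchanges them is this predicate for the transpose of Phi. *)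
Definition preserves_lines A := forall C, \rank C = 1%N ->
  (same_col A C -> same_col (Phi A) (Phi C)) /\
  (same_row A C -> same_row (Phi A) (Phi C)).

Lemma same_col_trans A B C : same_col A B -> same_col B C -> same_col A C.
Proof. exact: submx_trans. Qed.

Lemma same_row_trans A B C : same_row A B -> same_row B C -> same_row A C.
Proof. exact: submx_trans. Qed.

(* Two lines of different kinds through A never contain adjacent points off A, so
   a single pair (A, B) determines how Phi acts on all lines through A. *)
Lemma preserves_lines_col A B : nonnil1 A -> nonnil1 B -> same_col A B ->
  ~ same_row A B -> same_col (Phi A) (Phi B) -> preserves_lines A.
Proof.
move=> NA NB cAB nrAB cAB' C rC; have [rA rB] := (proj1 NA, proj1 NB).
have [[rA' rB'] rC'] := (iso_rank rA, iso_rank rB, iso_rank rC).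
have adjA := iso_adjacent NA rC; have adjB := iso_adjacent NB rC.
have cBA := same_col_sym rA rB cAB; have cBA' := same_col_sym rA' rB' cAB'.
split=> [cAC|rAC].
  have [//|rAC'] := (proj1 adjA) (or_introl cAC).
  have [cBC'|rBC'] := (proj1 adjB) (or_introl (same_col_trans cBA cAC)).
    exact: same_col_trans cAB' cBC'.
  case: nrAB; apply/proportional_same_row/(iso_proportional rA rB)/same_col_row => //.
  apply: same_row_trans rAC' _; exact: same_row_sym.
have [cAC'|//] := (proj1 adjA) (or_intror rAC).
have [cBC|rBC] := (proj2 adjB) (or_introl (same_col_trans cBA' cAC')).
  apply/proportional_same_row/(iso_proportional rA rC)/same_col_row => //.
  exact: same_col_trans cAB cBC.
by case: nrAB; apply: same_row_trans rAC _; apply: same_row_sym.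
Qed.

End Iso.

(** Conjugating Phi by transposition exchanges the two kinds of lines. *)
Lemma preserves_lines_row Phi A B : rank1_iso Phi -> nonnil1 A -> nonnil1 B ->
  same_row A B -> ~ same_col A B -> same_row (Phi A) (Phi B) -> preserves_lines Phi A.
Proof.
move=> iso NA NB rAB ncAB rAB' C rC.
have iso' := rank1_iso_tr (rank1_iso_pretr iso).
have := @preserves_lines_col _ iso' A^T B^T; rewrite !nonnil1_tr /same_col /same_row !trmxK.
move=> /(_ NA NB rAB ncAB rAB' C^T); rewrite mxrank_tr => /(_ rC).
by rewrite /same_col /same_row /= !trmxK => -[].
Qed.

Lemma preserves_lines_adjacent Phi A B : rank1_iso Phi -> nonnil1 A -> nonnil1 B ->
  preserves_lines Phi A -> adjacent A B -> preserves_lines Phi B.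
Proof.
move=> iso NA NB PA AB; have [rA rB] := (proj1 NA, proj1 NB).
have [rA' rB'] := (iso_rank iso rA, iso_rank iso rB).
have [PAc PAr] := PA B rB.
have [cAB|ncAB] := pselect (same_col A B).
  have [rAB|nrAB] := pselect (same_row A B).
    move=> C rC; have [PC PR] := PA C rC.
    by split=> [/(same_col_trans cAB)/PC|/(same_row_trans rAB)/PR];
      [apply: same_col_trans|apply: same_row_trans];
      [apply: same_col_sym|apply: same_row_sym]; auto.
  apply: (preserves_lines_col iso NB NA); [exact: same_col_sym| |exact/same_col_sym/PAc].
  by move/same_row_sym; auto.
have [//|rAB] := AB.
apply: (preserves_lines_row iso NB NA); [exact: same_row_sym| |exact/same_row_sym/PAr].
by move/same_col_sym; auto.
Qed.

(** Consecutive terms of the chain x f, x g, z g, z h are adjacent, and all terms are non-nilpotent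
    once g is nonzero at both x and z. *)
Lemma preserves_lines_all Phi A B : rank1_iso Phi -> nonnil1 A -> nonnil1 B ->
  preserves_lines Phi A -> preserves_lines Phi B.
Proof.
move=> iso /nonnil1P[x [f [x0 f0 -> fx]]] /nonnil1P[z [h [z0 h0 -> hz]]] PA.
have [|||g [_ gx gz]] := @dot_neq0_2 _ _ (fun=> True) x z.
- by [].
- by have [g] := dot_neq0 x0; exists g.
- by have [g] := dot_neq0 z0; exists g.
have g0 : g != 0 by apply: contraNneq gx => ->; rewrite dot0l.
have xg := nonnil1_outer gx; have zg := nonnil1_outer gz.
apply: (preserves_lines_adjacent iso zg (nonnil1_outer hz)).
  apply: (preserves_lines_adjacent iso xg zg).
    apply: (preserves_lines_adjacent iso (nonnil1_outer fx) xg PA).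
    by left; apply/same_col_outer => //; apply: proportional_refl.
  by right; apply/same_row_outer => //; apply: proportional_refl.
by left; apply/same_col_outer => //; apply: proportional_refl.
Qed.

Lemma rank1_iso_lines Phi : rank1_iso Phi ->
  (forall A, nonnil1 A -> preserves_lines Phi A) \/
  (forall A, nonnil1 A -> preserves_lines (fun A => (Phi A)^T) A).
Proof.
move=> iso.
have [A [B [NA NB cAB nrAB]]] : exists A B,
    [/\ nonnil1 A, nonnil1 B, same_col A B & ~ same_row A B].
  (* The test pair is E_00 and E_00 + E_01, idempotents with the same image and different
     kernels. *)
  pose i0 : 'I_n := Ordinal (ltn_trans (isT : 0 < 2)%N n3).
  pose i1 : 'I_n := Ordinal (ltn_trans (isT : 1 < 2)%N n3).
  pose x : 'cV[F]_n := delta_mx i0 0; pose f : 'rV[F]_n := delta_mx 0 i0.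
  pose e : 'rV[F]_n := delta_mx 0 i1.
  have fx : dot f x = 1 by rewrite /dot mul_delta_mx mxE !eqxx.
  have ex : dot (f + e) x = 1.
    by rewrite dotDl fx /dot mul_delta_mx_0 // mxE addr0.
  have fx0 : dot f x != 0 by rewrite fx oner_neq0.
  have ex0 : dot (f + e) x != 0 by rewrite ex oner_neq0.
  have x0 : x != 0 by apply: contraNneq fx0 => ->; rewrite dot0r.
  have f0 : f != 0 by apply: contraNneq fx0 => ->; rewrite dot0l.
  have e0 : f + e != 0 by apply: contraNneq ex0 => ->; rewrite dot0l.
  exists (x *m f), (x *m (f + e)); split; try exact: nonnil1_outer.
    by apply/same_col_outer => //; apply: proportional_refl.
  move/(same_row_outer x0 f0 x0 e0) => [c c0 /matrixP/(_ 0 i1)].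
  rewrite !mxE /= add0r mulr1 => E.
  by rewrite -E eqxx in c0.
have := proj1 (iso_adjacent iso NA (proj1 NB)) (or_introl cAB).
case=> [cAB'|rAB']; [left|right] => C NC.
  apply: (preserves_lines_all iso NA NC).
  exact: (preserves_lines_col iso NA NB).
have iso' := rank1_iso_tr iso; apply: (preserves_lines_all iso' NA NC).
by apply: (preserves_lines_col iso' NA NB) => //; rewrite /same_col !trmxK.
Qed.

(** The image of Phi(x f) is compared with that for one reference form nonzero at x, so its line
    depends on x only; the kernel likewise depends on f only. *)
Lemma rank1_iso_factor Phi : rank1_iso Phi ->
    (forall A, nonnil1 A -> preserves_lines Phi A) ->
  exists (psi : 'cV[F]_n -> 'cV[F]_n) (psi' : 'rV[F]_n -> 'rV[F]_n),
    [/\ forall x, x != 0 -> psi x != 0, forall f, f != 0 -> psi' f != 0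
      & forall x f, x != 0 -> f != 0 -> proportional (Phi (x *m f)) (psi x *m psi' f)].
Proof.
move=> iso lines.
have /choice[psi psiP] : forall x, exists y, x != 0 -> y != 0 /\
    forall f h z, f != 0 -> h != 0 -> z != 0 -> Phi (x *m f) = z *m h ->
      proportional z y.
  move=> x; have [->|x0] := eqVneq x 0; first by exists 0.
  have [f fx] := dot_neq0 x0; have [rN rA _ _] := iso.
  have f0 : f != 0 by apply: contraNneq fx => ->; rewrite dot0l.
  have [z [h [z0 h0 E]]] := rank1P (rN _ (rank_outer x0 f0)).
  exists z => _; split=> // g l w g0 l0 w0 Eg.
  have [+ _] := lines _ (nonnil1_outer fx) _ (rank_outer x0 g0).
  rewrite same_col_outer // E Eg same_col_outer // => H.
  by apply/proportional_sym/H/proportional_refl.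
have /choice[psi' psi'P] : forall f, exists g, f != 0 -> g != 0 /\
    forall x h z, x != 0 -> h != 0 -> z != 0 -> Phi (x *m f) = z *m h ->
      proportional h g.
  move=> f; have [->|f0] := eqVneq f 0; first by exists 0.
  have [x fx] := dot_neq0r f0; have [rN rA _ _] := iso.
  have x0 : x != 0 by apply: contraNneq fx => ->; rewrite dot0r.
  have [z [h [z0 h0 E]]] := rank1P (rN _ (rank_outer x0 f0)).
  exists h => _; split=> // g l w g0 l0 w0 Eg.
  have [_] := lines _ (nonnil1_outer fx) _ (rank_outer g0 f0).
  rewrite same_row_outer // E Eg same_row_outer // => H.
  by apply/proportional_sym/H/proportional_refl.
exists psi, psi'; split=> [x /psiP[]|f /psi'P[]|x f x0 f0] //.
have [rN _ _ _] := iso; have [z [h [z0 h0 E]]] := rank1P (rN _ (rank_outer x0 f0)).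
have [_ /(_ _ _ _ f0 h0 z0 E) zx] := psiP x x0.
have [_ /(_ _ _ _ x0 h0 z0 E) hf] := psi'P f f0.
by rewrite E; apply: proportional_mul.
Qed.

End RankOneMaps.

(** * Fundamental theorem of projective geometry *)

Section Incidence.
Variables (F : fieldType) (n : nat).
Hypothesis n3 : (2 < n)%N.
Variables (psi : 'cV[F]_n -> 'cV[F]_n) (psi' : 'rV[F]_n -> 'rV[F]_n).
Hypothesis psi0 : forall x : 'cV[F]_n, x != 0 -> psi x != 0.
Hypothesis psi'0 : forall f : 'rV[F]_n, f != 0 -> psi' f != 0.
Hypothesis inc : forall (x : 'cV[F]_n) (f : 'rV[F]_n), x != 0 -> f != 0 ->
  dot f x = 0 <-> dot (psi' f) (psi x) = 0.
Hypothesis psi_surj : forall z : 'cV[F]_n, z != 0 ->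
  exists2 x : 'cV[F]_n, x != 0 & proportional z (psi x).

Let e (i : 'I_n) : 'cV[F]_n := delta_mx i 0.
Let d (i : 'I_n) : 'rV[F]_n := delta_mx 0 i.

(* Normalization obtained by composing psi with a linear map. *)
Hypothesis psi_e : forall i j : 'I_n, i != j -> psi (e i) j 0 = 0.
Hypothesis psi_1 : psi (const_mx 1) = const_mx 1.

Lemma dotdE i (x : 'cV[F]_n) : dot (delta_mx 0 i) x = x i 0.
Proof. by rewrite /dot -rowE mxE. Qed.

Lemma doteE i (f : 'rV[F]_n) : dot f (delta_mx i 0) = f 0 i.
Proof. by rewrite /dot -colE mxE. Qed.

Lemma e_neq0 i : delta_mx i 0 != 0 :> 'cV[F]_n.
Proof. by apply/matrix0Pn; exists i, 0; rewrite mxE !eqxx oner_neq0. Qed.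

Lemma neq0_coord (x : 'cV[F]_n) i : x i 0 != 0 -> x != 0.
Proof. by move=> xi; apply/matrix0Pn; exists i, 0. Qed.

Lemma neq0_coordr (f : 'rV[F]_n) i : f 0 i != 0 -> f != 0.
Proof. by move=> fi; apply/matrix0Pn; exists 0, i. Qed.

Lemma dot_sum (f : 'rV[F]_n) (x : 'cV[F]_n) : dot f x = \sum_i f 0 i * x i 0.
Proof. by rewrite /dot mxE. Qed.

Lemma psi_ei i : psi (e i) i 0 != 0.
Proof.
have /matrix0Pn[j [k]] := psi0 (e_neq0 i); rewrite [k]ord1.
have [<-|ij] := eqVneq i j; first by [].
by rewrite (psi_e ij) eqxx.
Qed.

(** [psi (e i)] is a nonzero multiple of e_i, so incidence with e_i tests the i-th coordinate on
    both sides. *)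
Lemma psi'_eq0 (f : 'rV[F]_n) i : f != 0 -> f 0 i = 0 <-> psi' f 0 i = 0.
Proof.
move=> f0; rewrite -doteE inc ?e_neq0 // dot_sum (bigD1 i) //= big1.
  rewrite addr0; split=> [/eqP|->]; last by rewrite mul0r.
  by rewrite mulf_eq0 (negbTE (psi_ei i)) orbF => /eqP.
by move=> j ji; rewrite psi_e ?mulr0 // eq_sym.
Qed.

Lemma dot_supp (f : 'rV[F]_n) (x : 'cV[F]_n) (i j k : 'I_n) :
  i != j -> i != k -> j != k -> (forall l, l != i -> l != j -> l != k -> f 0 l = 0) ->
  dot f x = f 0 i * x i 0 + f 0 j * x j 0 + f 0 k * x k 0.
Proof.
move=> ij ik jk f0; rewrite dot_sum (bigD1 i) //= (bigD1 j) 1?eq_sym //=.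
rewrite (bigD1 k) /= ?(eq_sym k) ?ik ?jk // big1 ?addr0 ?addrA //.
by move=> l /andP[/andP[li lj] lk]; rewrite f0 ?mul0r.
Qed.

Lemma third (i j : 'I_n) : exists k : 'I_n, (k != i) && (k != j).
Proof.
have [k [k3 ki kj]] : exists k, [/\ (k < 3)%N, k != i :> nat & k != j :> nat].
  exists (if (0 != i :> nat) && (0 != j :> nat) then 0%N
          else if (1 != i :> nat) && (1 != j :> nat) then 1%N else 2%N).
  by case: ifP => [|?]; [|case: ifP]; split; lia.
by exists (Ordinal (leq_trans k3 n3)); rewrite -!val_eqE ki.
Qed.

Lemma psi_eq0 (x : 'cV[F]_n) i : x != 0 -> x i 0 = 0 <-> psi x i 0 = 0.
Proof.
move=> x0; have d0 : d i != 0 by apply: (@neq0_coordr _ i); rewrite mxE !eqxx oner_neq0.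
rewrite -dotdE inc // dot_sum (bigD1 i) //= big1 ?addr0; last first.
  move=> j ji; rewrite (proj1 (psi'_eq0 j d0)) ?mul0r // mxE.
  by rewrite (negbTE ji) andbF.
have di : psi' (d i) 0 i != 0.
  by apply/eqP => /(psi'_eq0 i d0) /eqP; rewrite mxE !eqxx oner_eq0.
split=> [/eqP|->]; last by rewrite mulr0.
by rewrite mulf_eq0 (negbTE di) => /eqP.
Qed.

Definition coord_map i j (t : F) := psi (e i + t *: e j) j 0 / psi (e i + t *: e j) i 0.

(** The equation x_j = t x_i is incidence with f = t d_i - d_j. The form psi' f again involves only
    the coordinates i and j, and its vanishing at the image of p = e_i + t e_j fixes the ratio of
    its coefficients. *)
Lemma coord_mapP i j t (x : 'cV[F]_n) : i != j -> x != 0 ->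
  x j 0 = t * x i 0 <-> psi x j 0 = coord_map i j t * psi x i 0.
Proof.
move=> ij x0; have [k /andP[ki kj]] := third i j.
have ji : j != i by rewrite eq_sym.
pose f := t *: d i - d j; pose p := e i + t *: e j.
have f0 : f != 0.
  apply: (@neq0_coordr _ j); rewrite !mxE !eqxx (negbTE ji) andbF mulr0 add0r.
  by rewrite oppr_eq0 oner_neq0.
have pi1 : p i 0 = 1 by rewrite !mxE !eqxx (negbTE ij) mulr0 addr0.
have pj : p j 0 = t by rewrite !mxE !eqxx (negbTE ji) mulr1 add0r.
have p0 : p != 0 by apply: (@neq0_coord _ i); rewrite pi1 oner_neq0.
have fE (z : 'cV[F]_n) : dot f z = t * z i 0 - z j 0.
  by rewrite /f -scaleN1r dotDl !dotZl !dotdE mulN1r.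
have supp l : l != i -> l != j -> psi' f 0 l = 0.
  move=> li lj; apply/(psi'_eq0 l f0); rewrite !mxE eqxx /= (negbTE li) (negbTE lj).
  by rewrite mulr0 subr0.
have f'E (z : 'cV[F]_n) : dot (psi' f) z = psi' f 0 i * z i 0 + psi' f 0 j * z j 0.
  rewrite (@dot_supp _ _ i j k) // ?(eq_sym _ k) //; last by move=> l ? ? _; apply: supp.
  by rewrite (supp k) // mul0r addr0.
have f'j : psi' f 0 j != 0.
  apply/eqP => /(psi'_eq0 j f0)/eqP; rewrite !mxE !eqxx (negbTE ji).
  by rewrite mulr0 add0r oppr_eq0 oner_eq0.
have p'i : psi p i 0 != 0.
  by apply/eqP => /(psi_eq0 i p0)/eqP; rewrite pi1 oner_eq0.
have : dot f p = 0 by rewrite fE pi1 pj mulr1 subrr.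
move=> /(inc p0 f0); rewrite f'E => E.
have {}E : psi' f 0 i = - psi' f 0 j * coord_map i j t.
  apply: (mulIf p'i); rewrite -mulrA /coord_map -/p divfK // mulNr.
  by apply/eqP; rewrite -subr_eq0 opprK E.
transitivity (dot f x = 0).
  by rewrite fE; split=> [->|/eqP]; rewrite ?subrr // subr_eq0 => /eqP.
rewrite inc // f'E E mulNr mulNr addrC -mulrA -mulrBr; split=> [/eqP|->].
  by rewrite mulf_eq0 (negbTE f'j) subr_eq0 => /eqP.
by rewrite subrr mulr0.
Qed.

Lemma coord_map1 i j : i != j -> coord_map i j 1 = 1.
Proof.
move=> ij; have x0 : const_mx 1 != 0 :> 'cV[F]_n.
  by apply: (@neq0_coord _ i); rewrite mxE oner_neq0.
by have [+ _] := coord_mapP 1 ij x0; rewrite psi_1 !mxE !mulr1 => /(_ erefl) <-.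
Qed.

Lemma psi_coord_eq i j (x : 'cV[F]_n) : x != 0 ->
  x i 0 = x j 0 -> psi x i 0 = psi x j 0.
Proof.
move=> x0 E; have [->|ij] := eqVneq j i; first by [].
by rewrite -[RHS]mul1r -(coord_map1 ij); apply/(coord_mapP 1 ij x0); rewrite mul1r.
Qed.

(** In the vector with 1 at i and t elsewhere, the coordinates j and k agree, and by the
    normalization of psi equal coordinates stay equal. *)
Lemma coord_map_right i j k t : i != j -> i != k -> coord_map i j t = coord_map i k t.
Proof.
move=> ij ik; pose x : 'cV[F]_n := \col_l (if l == i then 1 else t).
have xi : x i 0 = 1 by rewrite mxE eqxx.
have xj : x j 0 = t by rewrite mxE eq_sym (negbTE ij).
have xk : x k 0 = t by rewrite mxE eq_sym (negbTE ik).
have x0 : x != 0 by apply: (@neq0_coord _ i); rewrite xi oner_neq0.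
have y0 : psi x i 0 != 0 by apply/eqP => /(psi_eq0 i x0)/eqP; rewrite xi oner_eq0.
apply: (mulIf y0); rewrite -(proj1 (coord_mapP t ij x0)) ?xi ?mulr1 //.
rewrite -(proj1 (coord_mapP t ik x0)) ?xi ?mulr1 //.
by apply: psi_coord_eq; rewrite // xj.
Qed.

Lemma coord_map_left i j k t : i != j -> k != j -> coord_map i j t = coord_map k j t.
Proof.
move=> ij kj; pose x : 'cV[F]_n := \col_l (if l == j then t else 1).
have xi : x i 0 = 1 by rewrite mxE (negbTE ij).
have xk : x k 0 = 1 by rewrite mxE (negbTE kj).
have xj : x j 0 = t by rewrite mxE eqxx.
have x0 : x != 0 by apply: (@neq0_coord _ i); rewrite xi oner_neq0.
have y0 : psi x i 0 != 0 by apply/eqP => /(psi_eq0 i x0)/eqP; rewrite xi oner_eq0.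
apply: (mulIf y0); rewrite -(proj1 (coord_mapP t ij x0)) ?xi ?mulr1 //.
rewrite (psi_coord_eq (i := i) (j := k) x0) ?xi //.
by rewrite -(proj1 (coord_mapP t kj x0)) ?xk ?mulr1.
Qed.

Let i0 : 'I_n := Ordinal (ltn_trans (isT : 0 < 2)%N n3).
Let i1 : 'I_n := Ordinal (ltn_trans (isT : 1 < 2)%N n3).
Let i2 : 'I_n := Ordinal n3.

Definition coord_phi := coord_map i0 i1.

Lemma coord_mapE i j t : i != j -> coord_map i j t = coord_phi t.
Proof.
have base l : i0 != l -> coord_map i0 l t = coord_phi t.
  by move=> l0; apply: coord_map_right.
move=> ij; have [ji|ji] := eqVneq i0 j; last by rewrite (coord_map_left t ij ji) base.
have [k /andP[ki kj]] := third i j.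
have ik : i != k by rewrite eq_sym.
have i0k : i0 != k by rewrite ji eq_sym.
by rewrite (coord_map_right t ij ik) (coord_map_left t ik i0k) base.
Qed.

Lemma psi_ratio t i j (x : 'cV[F]_n) : i != j -> x != 0 ->
  x j 0 = t * x i 0 <-> psi x j 0 = coord_phi t * psi x i 0.
Proof. by move=> ij x0; rewrite coord_mapP // coord_mapE. Qed.

Definition col3 (a b c : F) : 'cV[F]_n :=
  \col_l (if l == i0 then a else if l == i1 then b else if l == i2 then c else 0).

Lemma col3E a b c :
  [/\ col3 a b c i0 0 = a, col3 a b c i1 0 = b & col3 a b c i2 0 = c].
Proof. by rewrite !mxE. Qed.

Lemma coord_phi1 : coord_phi 1 = 1.
Proof. exact: coord_map1. Qed.

Lemma coord_phi0 : coord_phi 0 = 0.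
Proof.
have ij : i0 != i1 by [].
have /(@psi_ratio 0 _ _ _ ij (e_neq0 i0)) : e i0 i1 0 = 0 * e i0 i0 0.
  by rewrite !mxE mul0r.
rewrite psi_e // => /esym/eqP; rewrite mulf_eq0 (negbTE (psi_ei i0)) orbF.
by move/eqP.
Qed.

Lemma psi_col3 b c : psi (col3 1 b c) i0 0 != 0 /\
  [/\ col3 1 b c != 0, psi (col3 1 b c) i1 0 = coord_phi b * psi (col3 1 b c) i0 0
    & psi (col3 1 b c) i2 0 = coord_phi c * psi (col3 1 b c) i0 0].
Proof.
have [x0 x1 x2] := col3E 1 b c.
have xn0 : col3 1 b c != 0 by apply: (@neq0_coord _ i0); rewrite x0 oner_neq0.
split; first by apply/eqP => /(psi_eq0 i0 xn0)/eqP; rewrite x0 oner_eq0.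
split=> //.
  by apply/(psi_ratio b (isT : i0 != i1) xn0); rewrite x0 x1 mulr1.
by apply/(psi_ratio c (isT : i0 != i2) xn0); rewrite x0 x2 mulr1.
Qed.

(** In the vector (1, t, st) the ratios of successive coordinates are t and s, and st is the ratio
    of the outer ones. *)
Lemma coord_phiM s t : coord_phi (s * t) = coord_phi s * coord_phi t.
Proof.
have [x0 x1 x2] := col3E 1 t (s * t); have [y0 [xn0 y1 y2]] := psi_col3 t (s * t).
apply: (mulIf y0); rewrite -y2 -mulrA -y1; apply/(psi_ratio s (isT : i1 != i2) xn0).
by rewrite x1 x2.
Qed.

(** The form f = d_0 + d_1 - d_2 kills (1, 0, 1) and (0, 1, 1), which forces the coefficients of
    psi' f to be proportional to 1, 1, -1. It also kills (1, t, 1 + t). *)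
Lemma coord_phi1D t : coord_phi (1 + t) = 1 + coord_phi t.
Proof.
pose f := d i0 + d i1 - d i2.
have fE (z : 'cV[F]_n) : dot f z = z i0 0 + z i1 0 - z i2 0.
  by rewrite /f -scaleN1r !dotDl dotZl !dotdE mulN1r.
have f0 : f != 0.
  by apply: (@neq0_coordr _ i0); rewrite !mxE /= addr0 subr0 oner_neq0.
have f'E (z : 'cV[F]_n) : dot (psi' f) z =
    psi' f 0 i0 * z i0 0 + psi' f 0 i1 * z i1 0 + psi' f 0 i2 * z i2 0.
  apply: dot_supp => // l l0 l1 l2; apply/(psi'_eq0 l f0).
  by rewrite !mxE (negbTE l0) (negbTE l1) (negbTE l2) /= addr0 subr0.
have f'2 : psi' f 0 i2 != 0.
  apply/eqP => /(psi'_eq0 i2 f0)/eqP.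
  by rewrite !mxE /= !add0r oppr_eq0 oner_eq0.
have f'0 : psi' f 0 i0 = - psi' f 0 i2.
  have [x0 x1 x2] := col3E 1 0 1; have [y0 [xn0 y1 y2]] := psi_col3 0 1.
  have /(inc xn0 f0) : dot f (col3 1 0 1) = 0 by rewrite fE x0 x1 x2 addr0 subrr.
  rewrite f'E y1 y2 coord_phi0 coord_phi1 mul0r mulr0 addr0 mul1r -mulrDl => /eqP.
  by rewrite mulf_eq0 (negbTE y0) orbF addr_eq0 => /eqP.
have f'1 : psi' f 0 i1 = - psi' f 0 i2.
  pose x := col3 0 1 1; have [x0 x1 x2] := col3E 0 1 1.
  have xn0 : x != 0 by apply: (@neq0_coord _ i1); rewrite x1 oner_neq0.
  have y0 : psi x i0 0 = 0 by apply/(psi_eq0 i0 xn0).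
  have y12 : psi x i1 0 = psi x i2 0 by apply: psi_coord_eq; rewrite // x1 x2.
  have y1 : psi x i1 0 != 0.
    by apply/eqP => /(psi_eq0 i1 xn0)/eqP; rewrite x1 oner_eq0.
  have /(inc xn0 f0) : dot f x = 0 by rewrite fE x0 x1 x2 add0r subrr.
  rewrite f'E y0 -y12 mulr0 add0r -mulrDl => /eqP.
  by rewrite mulf_eq0 (negbTE y1) orbF addr_eq0 => /eqP.
have [x0 x1 x2] := col3E 1 t (1 + t); have [y0 [xn0 y1 y2]] := psi_col3 t (1 + t).
have /(inc xn0 f0) : dot f (col3 1 t (1 + t)) = 0 by rewrite fE x0 x1 x2 subrr.
rewrite f'E f'0 f'1 !mulNr -opprD -mulrDr addrC => /eqP.
rewrite subr_eq0 => /eqP/(mulfI f'2).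
rewrite y1 y2 -{2}[psi _ i0 0]mul1r -mulrDl => /(mulIf y0) -> //.
Qed.

Lemma coord_phiD s t : coord_phi (s + t) = coord_phi s + coord_phi t.
Proof.
have [->|s0] := eqVneq s 0; first by rewrite coord_phi0 !add0r.
have -> : s + t = s * (1 + t / s) by rewrite mulrDr mulr1 mulrCA divff ?mulr1.
rewrite coord_phiM coord_phi1D mulrDr mulr1 -coord_phiM.
by rewrite mulrCA divff ?mulr1.
Qed.

Lemma coord_phi_surj s : exists t, coord_phi t = s.
Proof.
have [x0 x1 x2] := col3E 1 s 0; pose z := col3 1 s 0.
have zn0 : z != 0 by apply: (@neq0_coord _ i0); rewrite x0 oner_neq0.
have [x xn0 [c c0 E]] := psi_surj zn0.
have y0 : psi x i0 0 != 0.
  apply: contraTneq (oner_neq0 F) => y0.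
  by rewrite -x0 -/z E mxE y0 mulr0 eqxx.
have xi0 : x i0 0 != 0 by apply: contraNneq y0 => /(psi_eq0 i0 xn0) ->.
exists (x i1 0 / x i0 0); apply: (mulIf y0).
rewrite -(proj1 (psi_ratio _ (isT : i0 != i1) xn0)) ?divfK //.
apply: (mulfI c0); rewrite mulrCA.
have -> : c * psi x i0 0 = z i0 0 by rewrite E mxE.
have -> : c * psi x i1 0 = z i1 0 by rewrite E mxE.
by rewrite x0 x1 mulr1.
Qed.

Lemma coord_phi_rmorphism : exists2 phi : {rmorphism F -> F}, bijective phi &
  phi =1 coord_phi.
Proof.
have phiB : zmod_morphism coord_phi.
  move=> s t; apply/eqP; rewrite eq_sym subr_eq -coord_phiD subrK //.
have phi1M : monoid_morphism coord_phi by split; [exact: coord_phi1 | exact: coord_phiM].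
pose add := GRing.isZmodMorphism.Build F F coord_phi phiB.
pose mul := GRing.isMonoidMorphism.Build F F coord_phi phi1M.
pose phi : {rmorphism F -> F} := HB.pack coord_phi add mul.
have /choice[phi' phi'K] := coord_phi_surj.
exists phi => //; exists phi' => [t|//].
by apply: (fmorph_inj phi); apply: phi'K.
Qed.

Lemma psi_coord_phi (phi : {rmorphism F -> F}) : phi =1 coord_phi ->
  forall x, x != 0 -> proportional (psi x) (map_mx phi x).
Proof.
move=> phiE x x0; have [i [j xi]] := matrix0Pn _ x0; rewrite (ord1 j) in xi.
have yi : psi x i 0 != 0 by apply: contraNneq xi => /(psi_eq0 i x0) ->.
have pi0 : phi (x i 0) != 0 by rewrite fmorph_eq0.
exists (psi x i 0 / phi (x i 0)); first by rewrite mulf_neq0 ?invr_neq0.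
apply/matrixP=> l m; rewrite (ord1 m) !mxE.
have [->|il] := eqVneq l i; first by rewrite divfK.
rewrite (proj1 (@psi_ratio (x l 0 / x i 0) i l x _ x0)) ?divfK // 1?eq_sym //.
by rewrite -phiE fmorph_div mulrC mulrAC -mulrA.
Qed.

(** Otherwise some y is killed by phi(f) but not by psi' f. The inverse of phi turns y into an x
    with f x = 0, and psi x is proportional to y, against incidence. *)
Lemma psi'_coord_phi (phi : {rmorphism F -> F}) : bijective phi -> phi =1 coord_phi ->
  forall f, f != 0 -> proportional (psi' f) (map_mx phi f).
Proof.
move=> [phi' phiK phi'K] phiE f f0; apply: contrapT.
have pf0 : map_mx phi f != 0 by rewrite map_mx_eq0.
move=> /(proportional_sep pf0 (psi'0 f0)) [y fy f'y].
have yE : y = map_mx phi (map_mx phi' y) by apply/matrixP=> a b; rewrite !mxE phi'K.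
have x0 : map_mx phi' y != 0.
  by apply: contraNneq f'y => x0; rewrite yE x0 map_mx0 dot0r.
have fx : dot f (map_mx phi' y) = 0.
  apply: (fmorph_inj phi); rewrite rmorph0 -fy [in RHS]yE /dot -map_mxM.
  by rewrite [RHS]mxE.
have [c c0 E] := psi_coord_phi phiE x0.
by move/(inc x0 f0): fx; rewrite E -yE dotZr => /eqP; rewrite mulf_eq0 (negbTE c0) (negbTE f'y).
Qed.

End Incidence.

(** Composing psi with a matrix S and psi' with the inverse of S reaches the normalization of the
    coordinate argument; T is then the inverse of S. *)
Lemma incidence_semilinear (F : fieldType) n (psi : 'cV[F]_n -> 'cV[F]_n)
    (psi' : 'rV[F]_n -> 'rV[F]_n) :
    (2 < n)%N ->
    (forall x : 'cV[F]_n, x != 0 -> psi x != 0) ->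
    (forall f : 'rV[F]_n, f != 0 -> psi' f != 0) ->
    (forall (x : 'cV[F]_n) (f : 'rV[F]_n), x != 0 -> f != 0 ->
      dot f x = 0 <-> dot (psi' f) (psi x) = 0) ->
    (forall z : 'cV[F]_n, z != 0 -> exists2 x : 'cV[F]_n, x != 0 & proportional z (psi x)) ->
  exists (phi : {rmorphism F -> F}) (T : 'M[F]_n),
    [/\ bijective phi, T \in unitmx,
        forall x, x != 0 -> proportional (psi x) (T *m map_mx phi x)
      & forall f, f != 0 -> proportional (psi' f) (map_mx phi f *m invmx T)].
Proof.
move=> n3 psi0 psi'0 inc psi_surj.
pose e (i : 'I_n) : 'cV[F]_n := delta_mx i 0.
pose d (i : 'I_n) : 'rV[F]_n := delta_mx 0 i.
pose one : 'cV[F]_n := const_mx 1.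
have d0 i : d i != 0 by apply/matrix0Pn; exists 0, i; rewrite mxE !eqxx oner_neq0.
have e0 i : e i != 0 := e_neq0 F i.
have one0 : one != 0.
  apply/matrix0Pn; exists (Ordinal (ltn_trans (isT : 0 < 2)%N n3)), 0.
  by rewrite mxE oner_neq0.
pose u i := dot (psi' (d i)) (psi one).
have u0 i : u i != 0.
  apply/eqP => /(inc one (d i) one0 (d0 i))/eqP.
  by rewrite dotdE mxE oner_eq0.
(* The rows psi' (d i) kill psi (e j) for j different from i; dividing by [u i] makes S send psi of
   the all-ones vector to the all-ones vector. *)
pose S : 'M[F]_n := \matrix_(i, j) (psi' (d i) 0 j / u i).
have SE y i : (S *m y) i 0 = dot (psi' (d i)) y / u i.
  rewrite mxE /dot mxE mulr_suml; apply: eq_bigr => j _.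
  by rewrite mxE mulrAC.
have Se i j : i != j -> (S *m psi (e i)) j 0 = 0.
  move=> ij; rewrite SE; have -> : dot (psi' (d j)) (psi (e i)) = 0.
    by apply/(inc _ _ (e0 i) (d0 j)); rewrite dotdE mxE eq_sym (negbTE ij).
  by rewrite mul0r.
have Sei i : (S *m psi (e i)) i 0 != 0.
  rewrite SE mulf_neq0 ?invr_neq0 //; apply/eqP => /(inc _ _ (e0 i) (d0 i))/eqP.
  by rewrite dotdE mxE !eqxx oner_eq0.
have S1 : S *m psi one = const_mx 1.
  by apply/matrixP=> i j; rewrite (ord1 j) SE mxE; exact: divff (u0 i).
have uS : S \in unitmx.
  pose V : 'M[F]_n := \matrix_(i, j) psi (e j) i 0.
  have SVE : S *m V = diag_mx (\row_i (S *m psi (e i)) i 0).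
    apply/matrixP=> i j; transitivity ((S *m psi (e j)) i 0).
      by rewrite !mxE; apply: eq_bigr => l _; rewrite [V _ _]mxE.
    rewrite [RHS]mxE [X in X *+ _]mxE; have [->//|ij] := eqVneq i j.
    by rewrite Se // eq_sym.
  have : S *m V \in unitmx.
    rewrite SVE unitmxE det_diag unitfE; apply/prodf_neq0 => i _.
    by rewrite mxE.
  by rewrite unitmx_mul => /andP[].
pose psi1 x := S *m psi x; pose psi1' f := psi' f *m invmx S.
have psi10 x : x != 0 -> psi1 x != 0.
  move=> /psi0; apply: contraNneq => E.
  by rewrite -(mulKmx uS (psi x)) -/(psi1 x) E mulmx0.
have psi1'0 f : f != 0 -> psi1' f != 0.
  move=> /psi'0; apply: contraNneq => E.
  by rewrite -(mulmxKV uS (psi' f)) -/(psi1' f) E mul0mx.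
have inc1 x f : x != 0 -> f != 0 -> dot f x = 0 <-> dot (psi1' f) (psi1 x) = 0.
  by move=> x0 f0; rewrite inc // /dot /psi1' /psi1 mulmxA mulmxKV.
have surj1 z : z != 0 -> exists2 x, x != 0 & proportional z (psi1 x).
  move=> z0; have [|x x0 [c c0 E]] := psi_surj (invmx S *m z).
    by apply: contraNneq z0 => E; rewrite -(mulKVmx uS z) E mulmx0.
  exists x => //; exists c => //.
  by rewrite -(mulKVmx uS z) E /psi1 scalemxAr.
have [phi phi_bij phiE] := coord_phi_rmorphism n3 psi10 inc1 surj1 Se S1.
exists phi, (invmx S); split; rewrite ?unitmx_inv //.
  move=> x x0; rewrite -(mulKmx uS (psi x)); apply: proportional_mul.
    exact: proportional_refl.
  exact: (psi_coord_phi psi10 inc1 Se S1 phiE).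
move=> f f0; rewrite -(mulmxKV uS (psi' f)) invmxK; apply: proportional_mul.
  exact: (psi'_coord_phi psi10 psi1'0 inc1 Se S1 phi_bij phiE).
exact: proportional_refl.
Qed.

(** * Semilinear form on rank-one matrices *)

Lemma rank1_iso_form (F : fieldType) n (Phi : 'M[F]_n -> 'M[F]_n) :
    (2 < n)%N -> rank1_iso Phi ->
    (forall A, nonnil1 A -> preserves_lines Phi A) ->
  exists (phi : {rmorphism F -> F}) (T : 'M[F]_n),
    [/\ bijective phi, T \in unitmx
      & forall A, \rank A = 1%N ->
          proportional (Phi A) (T *m map_mx phi A *m invmx T)].
Proof.
move=> n3 iso lines; have [psi [psi' [psi0 psi'0 PhiE]]] := rank1_iso_factor iso lines.
have [r s N o] := iso.
have [||phi [T [phi_bij uT psiE psi'E]]] := @incidence_semilinear F n psi psi' n3 psi0 psi'0.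
(* The incidence f x = 0 means that x f is nilpotent, and Phi respects nilpotency. *)
- have nonnil1E (x : 'cV[F]_n) (f : 'rV[F]_n) : nonnil1 (x *m f) -> dot f x != 0.
    by move=> [_]; rewrite mul_outer scaler_eq0 negb_or => /andP[].
  move=> x f x0 f0; have [c c0 E] := PhiE x f x0 f0.
  have NE := N _ (rank_outer x0 f0); rewrite E scalemxAl in NE.
  have cE : dot (psi' f) (c *: psi x) = 0 <-> dot (psi' f) (psi x) = 0.
    rewrite dotZr; split=> [/eqP|->]; last by rewrite mulr0.
    by rewrite mulf_eq0 (negbTE c0) => /eqP.
  rewrite -cE; split=> /eqP fx; apply/eqP; apply: contraTT fx => fx.
    by apply/nonnil1E/NE/nonnil1_outer.
  by apply/nonnil1E/NE/nonnil1_outer.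
- move=> z z0; have [h hz] := dot_neq0 z0.
  have h0 : h != 0 by apply: contraNneq hz => ->; rewrite dot0l.
  have [A rA E] := s _ (rank_outer z0 h0); have [x [f [x0 f0 EA]]] := rank1P rA.
  exists x => //; have := PhiE _ _ x0 f0; rewrite -EA E.
  move/proportional_same_col/same_col_outer; apply=> //.
    exact: psi0.
  exact: psi'0.
exists phi, T; split=> // A /rank1P[x [f [x0 f0 ->]]].
apply: proportional_trans (PhiE _ _ x0 f0) _.
rewrite map_mxM mulmxA -mulmxA; apply: proportional_mul; first exact: psiE.
exact: psi'E.
Qed.

Theorem theorem2p1 (F : closedFieldType) (n k : nat)
    (hn : (3 <= n)%N) (hk : (2 <= k)%N)
    (alpha : 'S_k -> F) (halpha : \sum_(s : 'S_k) alpha s != 0)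
    (D1 D2 : set 'M[F]_n)
    (D1_rank1 : [set A | \rank A = 1%N] `<=` D1)
    (D1_idem : [set A | idempotent_mx A /\ \rank A = n.-1] `<=` D1)
    (D2_rank1 : [set A | \rank A = 1%N] `<=` D2)
    (D2_idem : [set A | idempotent_mx A /\ \rank A = n.-1] `<=` D2)
    (Phi : 'M[F]_n -> 'M[F]_n)
    (Phi_fun : set_fun D1 D2 Phi) (Phi_surj : set_surj D1 D2 Phi)
    (Phi_zeros : strongly_preserves_zeros alpha D1 Phi) :
  exists (phi : {rmorphism F -> F}) (gamma : 'M[F]_n -> F) (T : 'M[F]_n),
    [/\ bijective phi,
        forall A, (D1 `\ 0) A -> gamma A != 0,
        T \in unitmx
      & (forall A, \rank A = 1%N ->
           Phi A = gamma A *: (T *m map_mx phi A *m invmx T))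
        \/
        (forall A, \rank A = 1%N ->
           Phi A = gamma A *: (T *m (map_mx phi A)^T *m invmx T))].
Proof.
pose R A B := D1 A /\ Phi A = B.
have RC : zero_correspondence alpha R.
  split.
  - split=> A HA; exists (Phi A); split=> //; first exact: D1_rank1.
    exact: D1_idem.
  - split=> B HB.
      by have [A DA E] := Phi_surj B (D2_rank1 B HB); exists A.
    by have [A DA E] := Phi_surj B (D2_idem B HB); exists A.
  split=> [A _ X _ [DA <-] [DX <-]|A _ [DA <-]].
    have slotD (j i : 'I_k) : D1 (slot j A X i) by rewrite /slot; case: ifP.
    have slotE (j : 'I_k) : (fun i => Phi (slot j A X i)) = slot j (Phi A) (Phi X).
      by apply: funext => i; rewrite /slot; case: ifP.
    split=> Z j; have [PZ PZ'] := Phi_zeros _ (slotD j).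
      by rewrite -slotE; apply: PZ.
    by apply: PZ'; rewrite slotE.
  by rewrite -!(eval_const_eq0 halpha); apply: Phi_zeros.
have RP A : \rank A = 1%N -> R A (Phi A) by split=> //; apply: D1_rank1.
have RC' := zero_correspondence_sym RC.
have iso : rank1_iso Phi.
  split=> [A rA|B rB|A rA|A X rA NX].
  - exact: (zero_correspondence_rank1 hn hk halpha RC (RP A rA) rA).
  - have [A DA E] := Phi_surj B (D2_rank1 B rB); exists A => //.
    exact: (zero_correspondence_rank1 hn hk halpha RC' (conj DA E) rB).
  - split; first exact: (zero_correspondence_nonnil1 hn hk halpha RC (RP A rA)).
    exact: (zero_correspondence_nonnil1 hn hk halpha RC' (RP A rA)).
  - have [_ _ [RZ _]] := RC; have RX := RP X (proj1 NX).
    have NX' := zero_correspondence_nonnil1 hn hk halpha RC RX NX.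
    rewrite -!(slot_zero_orth_nonnil1 hk halpha) //.
    exact: (RZ _ _ _ _ (RP A rA) RX).
have gammaP (G : 'M[F]_n -> 'M[F]_n) :
    (forall A, \rank A = 1%N -> proportional (Phi A) (G A)) ->
  exists gamma : 'M[F]_n -> F, (forall A, gamma A != 0) /\
    forall A, \rank A = 1%N -> Phi A = gamma A *: G A.
  move=> PhiG.
  have /choice[gamma gammaP] A : exists c : F, c != 0 /\ (\rank A = 1%N -> Phi A = c *: G A).
    have [rA|rA] := eqVneq (\rank A) 1%N; last first.
      (* Matrices of rank other than one get the value 1, so gamma never vanishes. *)
      by exists 1; split=> [|/eqP]; rewrite ?oner_neq0 ?(negbTE rA).
    by have [c c0 E] := PhiG A rA; exists c.
  by exists gamma; split=> A; have [] := gammaP A.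
have [lines|lines] := rank1_iso_lines hn iso.
  have [phi [T [phi_bij uT /gammaP[gamma [gamma0 PhiE]]]]] := rank1_iso_form hn iso lines.
  by exists phi, gamma, T; split=> //; left.
(* Lines are exchanged: the form found for the transpose of Phi is transposed back, turning T into
   the inverse of its transpose. *)
have [phi [T [phi_bij uT TE]]] := rank1_iso_form hn (rank1_iso_tr iso) lines.
have [|gamma [gamma0 PhiE]] := gammaP (fun A => invmx T^T *m (map_mx phi A)^T *m T^T).
  move=> A rA; apply/proportional_tr; rewrite !trmx_mul !trmxK.
  by rewrite trmx_inv trmxK mulmxA; apply: TE.
exists phi, gamma, (invmx T^T); rewrite invmxK unitmx_inv unitmx_tr.
by split=> //; right.
Qed.
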